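(* Let $r:(0,\infty)\to\mathbb R$ be any function with $r(t)\to\infty$ as $t\to\infty$. Then there exists a translation surface $(X,\omega)$, with $\omega$ having at least one zero, whose vertical foliation $\mathcal F_v$ is nonergodic and whose associated Teichmüller geodesic $(X_t)_{t>0}$ satisfies $$\liminf_{t\to\infty}\frac{d(t)}{r(t)}<1,$$ where $d(t)=-2\log\ell(X_t)$ and $\ell(X_t)$ is the length of the shortest saddle connection in $X_t$.
   Context: A translation surface $(X,\omega)$ is a closed (compact, connected) Riemann surface $X$ with a nonzero holomorphic $1$-form $\omega$. The line element $|\omega|$ induces a flat metric on $X$ with cone-type singularities at the zeroes of $\omega$. A saddle connection is a geodesic segment for this flat metric that joins a pair of (not necessarily distinct) zeroes of $\omega$ without passing through a zero in its interior. The vertical foliation $\mathcal F_v$ is defined by $\operatorname{Re}\omega=0$; its leaves are the vertical lines in the natural parameters, i.e. the charts $\varphi_\alpha$ away from the zeroes with $d\varphi_\alpha=\omega$. $\mathcal F_v$ is nonergodic if it is not ergodic with respect to Lebesgue (flat area) measure, i.e. there is a measurable subset of $X$ that is a union of leaves of $\mathcal F_v$ and such that both it and its complement have positive area. Teichmüller flow and geodesic: $X_t$ is the translation surface obtained from $(X,\omega)$ by post-composing the natural parameters with the $\mathbb R$-linear map $z\mapsto e^{t/2}\operatorname{Re}z+i\,e^{-t/2}\operatorname{Im}z$; equivalently it is the same topological surface with the $1$-form $\omega_t=e^{t/2}\operatorname{Re}\omega+i\,e^{-t/2}\operatorname{Im}\omega$ (holomorphic for the new complex structure). Length in $X_t$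 is measured in the flat metric $|\omega_t|$. *)

(* Defs.v *)
From HB Require Import structures.
From mathcomp Require Import all_boot all_order all_algebra.
From mathcomp Require Import complex.
From mathcomp Require Import all_classical all_reals all_analysis.

Set Implicit Arguments.
Unset Strict Implicit.
Unset Printing Implicit Defensive.

Import Order.TTheory GRing.Theory Num.Theory.
Import numFieldNormedType.Exports.

Local Open Scope classical_set_scope.
Local Open Scope ring_scope.
Local Open Scope complex_scope.

(* R[i]^o is the normed module R[i] over the field R[i] itself, so that
   differentiability of maps cplx R -> cplx R is complex differentiability. *)
Definition cplx (R : realType) := (R[i])^o.

(* The map is only meaningful on the domain. *)
Record local_param (R : realType) (X : Type) := LocalParam {
  dom : set X;
  param :> X -> cplx R }.

(* The inverse of c on c @` dom c; p is only a junk value off c @` dom c. *)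
Definition param_inv (R : realType) (X : Type) (c : local_param R X) (p : X) :
  cplx R -> X := 'pinv_(fun=> p) (dom c) c.

(* Homeomorphism of an open set onto an open subset of the complex plane. *)
Definition is_chart (R : realType) (X : topologicalType)
    (c : local_param R X) : Prop :=
  [/\ open (dom c),
      {within dom c, continuous c},
      set_inj (dom c) c &
      forall V : set X, open V -> V `<=` dom c -> open (c @` V)].

(* The function f on X has derivative a at p in the coordinate c, i.e.
   df = a dc at p. *)
Definition has_coord_derivative (R : realType) (X : Type)
    (c : local_param R X) (p : X) (f : X -> cplx R) (a : cplx R) : Prop :=
  is_derive (c p) 1 (f \o param_inv c p) a.

Record closed_riemann_surface (R : realType) := ClosedRiemannSurface {
  points :> topologicalType;
  atlas : set (local_param R points);
  points_hausdorff : hausdorff_space points;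
  points_compact : compact [set: points];
  points_connected : connected [set: points];
  atlas_cover : forall p : points, exists2 c, atlas c & dom c p;
  atlas_chart : forall c, atlas c -> is_chart c;
  atlas_holomorphic : forall c e, atlas c -> atlas e ->
    forall p, dom c p -> dom e p ->
      exists a, has_coord_derivative c p e a }.

(* The form is coef c dc on the domain of each chart c of the atlas. *)
Record translation_surface (R : realType) := TranslationSurface {
  surface :> closed_riemann_surface R;
  coef : local_param R surface -> surface -> cplx R;
  coef_holomorphic : forall c, atlas c ->
    forall p, dom c p -> exists a, has_coord_derivative c p (coef c) a;
  coef_change : forall c e, atlas c -> atlas e ->
    forall p, dom c p -> dom e p ->
      forall a, has_coord_derivative c p e a ->
        coef c p = coef e p * a;
  form_nonzero : exists c p, [/\ atlas c, dom c p & coef c p != 0] }.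

Definition zeros (R : realType) (S : translation_surface R) : set S :=
  [set p | forall c, atlas c -> dom c p -> coef c p = 0].
Arguments zeros {R} S.

(* A natural parameter: a chart phi away from the zeros with d phi = omega. *)
Definition natural_param (R : realType) (S : translation_surface R)
    (phi : local_param R S) : Prop :=
  [/\ is_chart phi,
      dom phi `<=` ~` zeros S &
      forall c, atlas c -> forall p, dom c p -> dom phi p ->
        has_coord_derivative c p phi (coef c p)].

Record flat_structure (R : realType) (X : Type) := FlatStructure {
  singularities : set X;
  natural : set (local_param R X) }.

Definition flat (R : realType) (S : translation_surface R) :
    flat_structure R S :=
  FlatStructure (zeros S) [set phi | natural_param phi].

(* Deforming the natural parameters determines the translation surface X_t, and
   saddle connections and their lengths depend on nothing else. *)
Definition teich_map (R : realType) (t : R) (z : cplx R) : cplx R :=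
  (expR (t / 2) * complex.Re z) +i* (expR (- (t / 2)) * complex.Im z).

Definition teich (R : realType) (X : Type) (t : R) (F : flat_structure R X) :
    flat_structure R X :=
  FlatStructure (singularities F)
    [set LocalParam (dom phi) (teich_map t \o phi) | phi in natural F].

(* On ]a, b[, gamma avoids the singularities and moves with constant velocity
   v in every natural parameter. As the flat metric is the Euclidean metric in
   natural parameters, these are its constant-speed geodesics off the
   singularities, of speed `|v|. *)
Definition straight (R : realType) (X : Type) (F : flat_structure R X)
    (v : cplx R) (a b : R) (gamma : R -> X) : Prop :=
  forall s, a < s < b ->
    ~ singularities F (gamma s) /\
    forall phi, natural F phi -> dom phi (gamma s) ->
      \forall u \near s, dom phi (gamma u) /\
        phi (gamma u) = phi (gamma s) + (u - s)%:C * v.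

(* Parametrized by the unit interval, so that v is its holonomy. *)
Definition saddle_connection (R : realType) (X : topologicalType)
    (F : flat_structure R X) (v : cplx R) (gamma : R -> X) : Prop :=
  [/\ v != 0,
      {within `[0, 1], continuous gamma},
      straight F v 0 1 gamma,
      singularities F (gamma 0) &
      singularities F (gamma 1)].

Definition saddle_lengths (R : realType) (X : topologicalType)
    (F : flat_structure R X) : set R :=
  [set l | exists v gamma,
     saddle_connection F v gamma /\ l = ComplexField.Normc.normc v].

(* The infimum is attained: the set of holonomies of saddle connections of a
   translation surface is discrete, and it is nonempty if there is a zero. *)
Definition shortest_saddle_length (R : realType) (X : topologicalType)
    (F : flat_structure R X) : R := inf (saddle_lengths F).

Definition borel (X : topologicalType) : set (set X) :=
  <<s [set U : set X | open U] >>.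

Definition plane_area (R : realType) (A : set (cplx R)) : \bar R :=
  (@lebesgue_measure R \x @lebesgue_measure R)%E
    [set (complex.Re z, complex.Im z) | z in A].

(* The measure on X that is Lebesgue measure in every natural parameter and
   gives no mass to the singularities: the area of A is the supremum of the
   areas of finite disjoint families of Borel pieces of A, each lying in the
   domain of a natural parameter. On a set that is not Borel this is the
   inner measure, which is the completed measure on measurable sets. *)
Definition area (R : realType) (X : topologicalType) (F : flat_structure R X)
    (A : set X) : \bar R :=
  ereal_sup [set m | exists (n : nat) (B : 'I_n -> set X)
                            (phi : 'I_n -> local_param R X),
    [/\ forall i, borel (B i) /\ B i `<=` A,
        trivIset [set: 'I_n] B,
        forall i, natural F (phi i) /\ B i `<=` dom (phi i) &
        m = (\sum_(i < n) plane_area (phi i @` B i))%E]].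

(* Lebesgue measurability: Borel up to a set of zero area. *)
Definition area_measurable (R : realType) (X : topologicalType)
    (F : flat_structure R X) (A : set X) : Prop :=
  exists B D : set X, [/\ borel B, borel D, B `<=` A, A `<=` D &
    area F (D `\` B) = 0%E].

(* The leaf through x of the foliation Re omega = 0 (the maximal vertical line
   through x in X minus the singularities). *)
Definition vertical_leaf (R : realType) (X : Type) (F : flat_structure R X)
    (x : X) : set X :=
  [set y | exists a b gamma, straight F 'i a b gamma /\
     exists s u, [/\ a < s < b, a < u < b, gamma s = x & gamma u = y]].

(* The singularities are on no leaf, so membership of these finitely many
   points is unconstrained. *)
Definition union_of_leaves (R : realType) (X : Type) (F : flat_structure R X)
    (A : set X) : Prop :=
  forall x, A x -> ~ singularities F x -> vertical_leaf F x `<=` A.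

Definition vertical_nonergodic (R : realType) (X : topologicalType)
    (F : flat_structure R X) : Prop :=
  exists A : set X, [/\ area_measurable F A, union_of_leaves F A,
    (0 < area F A)%E & (0 < area F (~` A))%E].

Definition teich_depth (R : realType) (S : translation_surface R) (t : R) : R :=
  - 2 * ln (shortest_saddle_length (teich t (flat S))).

(* Main.v *)
(* Let T be the torus C / L, where z is in the lattice L if both Im z and
   xi z = Re z + alpha * Im z are integers: the vertical flow of T first returns
   to the circle Im z = 0 by the rotation x |-> x + alpha.  The surface is the
   double cover of T branched over 0 and beta, whose sheets are exchanged across
   the slit [0, beta].  Choose alpha with rational approximations p_k / q_k and
   eta_k = q_k alpha - p_k such that q_k eta_k is about 2^-k, and let
   beta = sum_k 2 eta_k (Veech's construction).

   Nonergodicity: mod 2 the indicator of an interval of length 2 eta_k is a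
   coboundary for the rotation, with a transfer function supported on a set of
   measure at most q_k eta_k.  As these measures are summable, the transfer
   functions add up to one for the slit [0, beta], whose graph is an invariant
   set.

   Depth: a saddle connection has its holonomy w in L, L + beta or L - beta.
   The vector v_k = (-eta_k, q_k) of L is primitive, and the determinant of w
   and v_k is, up to sign, an integer or differs from an integer by q_k beta,
   which is at distance at least 2^-(k+4) from the integers.  At time
   t = 2 ln q_k the deformed v_k has length about 1, so either w is a multiple
   of v_k or its deformed length is at least 2^-(k+5).  The q_k may grow as fast
   as we like, which makes -2 ln (2^-(k+5)) small compared with r (2 ln q_k). *)
Require Import Defs.
From HB Require Import structures.
From mathcomp Require Import all_boot all_order all_algebra.
From mathcomp Require Import complex ring lra zify.
From mathcomp Require Import all_classical all_reals all_analysis.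
Set Implicit Arguments.
Unset Strict Implicit.
Unset Printing Implicit Defensive.
Import Order.TTheory GRing.Theory Num.Theory numFieldNormedType.Exports.
Local Open Scope classical_set_scope.
Local Open Scope ring_scope.
Local Open Scope complex_scope.

(** The two halves pull q_k eta_k in opposite directions: nonergodicity needs these numbers
    summable, while the lower bound on saddle connections loses their logarithm. With 2^-k the loss
    is linear in k, and since q_k may grow freely, [r (2 * ln q_k)] can be made at least twice the
    loss; the limit inferior is then at most 1/2. The distance from q_k beta to the integers rests
    on q_k eta_j - q_j eta_k being an integer: mod 1 the terms before k become multiples of eta_k.
    All terms are nonnegative, so nothing cancels. The q_k are powers of 2, which reduces
    coprimality to odd numerators. No gluing is performed: the surface is a set of normal forms of
    pairs (plane point, sheet), its open sets are given by germs, and one predicate [good_chart]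
    covers both regular and branch charts. *)

Local Notation Re := complex.Re.
Local Notation Im := complex.Im.

(** * The plane *)

Section plane.
Context {R : realType}.
Implicit Types (z w u v h : cplx R) (x y : R).

Lemma ReD z w : Re (z + w) = Re z + Re w. Proof. by case: z; case: w. Qed.
Lemma ImD z w : Im (z + w) = Im z + Im w. Proof. by case: z; case: w. Qed.
Lemma ReN z : Re (- z) = - Re z. Proof. by case: z. Qed.
Lemma ImN z : Im (- z) = - Im z. Proof. by case: z. Qed.
Lemma Re_sqr z : Re (z ^+ 2) = Re z ^+ 2 - Im z ^+ 2.
Proof. by case: z => a b; rewrite !expr2. Qed.
Lemma Im_sqr z : Im (z ^+ 2) = 2 * (Re z * Im z).
Proof. case: z => a b; rewrite !expr2 /=; ring. Qed.
Definition cplxE := (ReD, ImD, ReN, ImN).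

Lemma cplx_eqP z w : z = w <-> Re z = Re w /\ Im z = Im w.
Proof. by split=> [->//|]; case: z => a b; case: w => c d /= [-> ->]. Qed.

Lemma nbhs_boxP z (P : set (cplx R)) :
  nbhs z P <-> exists2 e : R, 0 < e &
    forall w, `|Re w - Re z| < e -> `|Im w - Im z| < e -> P w.
Proof.
split.
  move=> /nbhs_ballP[e /= e0 eP].
  have [e1 eE] : exists e1 : R, e = e1%:C.
    by exists (Re e); rewrite RRe_real// gtr0_real.
  move: e0 eP; rewrite {}eE => e0 eP.
  have e10 : 0 < e1 by move: e0; rewrite ltcR.
  exists (e1 / 2); first by rewrite divr_gt0.
  move=> w wR wI; apply: eP; rewrite /ball/= /ball_ normc_def ltcR.
  case: z w wR wI => a b [c d] /= wR wI; rewrite -[ltRHS]gtr0_norm//.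
  rewrite -sqrtr_sqr ltr_sqrt ?exprn_gt0//.
  move: wR wI; rewrite !ltr_norml => /andP[? ?] /andP[? ?]; nra.
move=> [e e0 eP]; apply/nbhs_ballP; exists e%:C; first by rewrite /= ltcR.
move=> w; rewrite /ball/= /ball_ normc_def ltcR !cplxE => we.
by apply: eP; rewrite distrC; apply: le_lt_trans we;
  rewrite -sqrtr_sqr ler_wsqrtr// ?lerDl ?lerDr sqr_ge0.
Qed.

Lemma near_boxP z (P : cplx R -> Prop) :
  (\forall w \near z, P w) <-> exists2 e : R, 0 < e &
    forall h, `|Re h| < e -> `|Im h| < e -> P (z + h).
Proof.
split=> [/nbhs_boxP|] [e e0 eP].
  by exists e => // h hR hI; apply: eP; rewrite cplxE addrC addKr.
apply/nbhs_boxP; exists e => //.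
by move=> w wR wI; rewrite -(subrK z w) addrC; apply: eP; rewrite !cplxE.
Qed.

Lemma near0P z (P : cplx R -> Prop) :
  (\forall w \near z, P w) <-> (\forall h \near (0 : cplx R), P (z + h)).
Proof.
split=> /near_boxP[e e0 eP]; apply/near_boxP; exists e => // h hR hI.
  by rewrite add0r; exact: eP.
by rewrite -[h]add0r; apply: eP.
Qed.

(** Carathéodory's criterion. It suits transition maps, where the increment of [f] factors
    explicitly and no difference quotient has to be estimated. *)
Lemma derive_caratheodory (f k : cplx R -> cplx R) u :
  {for u, continuous k} ->
  (\forall v \near u, f v - f u = (v - u) * k v) ->
  is_derive u (1 : cplx R) f (k u).
Proof.
move=> kc fk.
pose G (h : cplx R) : cplx R :=
  (h : R[i])^-1 *: ((f \o shift u) ((h : R[i]) *: (1 : cplx R)) - f u).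
have H : G h @[h --> (0 : cplx R)^'] --> k u.
  move=> A /kc kA.
  have kA0 : \forall h \near (0 : cplx R), A (k (u + h)).
    by apply: (near0P u (fun v => A (k v))).1.
  have fk0 : \forall h \near (0 : cplx R),
      f (u + h) - f u = (u + h - u) * k (u + h).
    by move/near0P : fk.
  rewrite nbhs_simpl /=; near=> h.
  have h0 : h != 0 by near: h; exact: nbhs_dnbhs_neq.
  change (A (G h)); have -> : G h = k (u + h).
    rewrite /G /= [h *: _]mulr1 [h + u]addrC.
    have -> : f (u + h) - f u = h * k (u + h).
      rewrite (_ : h * _ = (u + h - u) * k (u + h)); last first.
        by rewrite [u + h]addrC addrK.
      by near: h; apply: cvg_within.
    by rewrite [_ *: _]mulrA mulVf// mul1r.
  by near: h; apply: cvg_within.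
split; first by apply/cvg_ex; exists (k u).
by apply: cvg_lim.
Unshelve. all: by end_near. Qed.

(** If v is the square root of u^2 + h nearer to u, then |v - u|^2 <= |v - u| |v + u| = |h|. The
    estimate includes u = 0. *)
Lemma sqrt_near u (W : set (cplx R)) : nbhs u W ->
  \forall h \near (0 : cplx R), exists2 v, W v & v ^+ 2 = u ^+ 2 + h.
Proof.
move=> /nbhs_ballP[e /= e0 eW].
apply/nbhs_ballP; exists (e ^+ 2); first exact: exprn_gt0.
move=> h; rewrite /ball/= /ball_ sub0r normrN => he.
have [v0 v0E] : exists v, v ^+ 2 = u ^+ 2 + h by exists (sqrtC (u ^+ 2 + h)); rewrite sqrtCK.
wlog vu : v0 v0E / `|u - v0| <= `|u + v0|.
  move=> W0; have : (`|u - v0| <= `|u + v0|) || (`|u + v0| <= `|u - v0|).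
    by apply: real_leVge; exact: normr_real.
  case/orP => [/W0|vu]; first exact.
  by apply: (W0 (- v0)); rewrite ?sqrrN// opprK.
exists v0 => //; apply: eW; rewrite /ball/= /ball_.
have E : (v0 - u) * (v0 + u) = h by rewrite -subr_sqr v0E addrC addKr.
rewrite -(ltr_pXn2r (n := 2))// ?nnegrE ?normr_ge0 ?ltW//.
apply: le_lt_trans he; rewrite -E normrM expr2 distrC [v0 + u]addrC.
by rewrite ler_wpM2l// distrC.
Qed.

Lemma near_neq0 z : z != 0 -> nbhs z [set w | w != 0].
Proof.
move=> z0; apply/nbhs_ballP; exists `|z|; first by rewrite /= normr_gt0.
move=> w; rewrite /ball/= /ball_; apply: contraTneq => ->.
by rewrite subr0 ltxx.
Qed.

End plane.

(** * Fractional parts; locally constant predicates on an interval *)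

Section frac.
Context {R : realType}.
Implicit Types (x y : R).

Definition frac x : R := x - (Num.floor x)%:~R.

Lemma frac_ge0 x : 0 <= frac x.
Proof. by rewrite subr_ge0 floor_le_tmp. Qed.

Lemma frac_lt1 x : frac x < 1.
Proof. by rewrite ltrBlDl -[1]/(1%:~R) -intrD floorD1_gt. Qed.

Lemma frac_id x : 0 <= x < 1 -> frac x = x.
Proof. by move=> x01; rewrite /frac (@floor_def _ x 0) ?subr0. Qed.

Lemma fracDz x y : y \is a Num.int -> frac (x + y) = frac x.
Proof.
move=> yz; rewrite /frac floorDrz// intrD.
by have /eqP -> := (etrans (esym (intrEfloor y)) yz); rewrite opprD addrACA subrr addr0.
Qed.

Lemma eq_frac x y : (frac x == frac y) = (x - y \is a Num.int).
Proof.
apply/eqP/idP => [xy|xyz]; last by rewrite -(subrK y x) addrC fracDz.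
have -> : x - y = (Num.floor x - Num.floor y)%:~R; last exact: intr_int.
by rewrite intrB; move: xy; rewrite /frac; lra.
Qed.

Lemma sub_frac_int x : x - frac x \is a Num.int.
Proof. by rewrite /frac opprB addrC subrK intr_int. Qed.

Lemma frac_uniq x y : 0 <= y < 1 -> x - y \is a Num.int -> frac x = y.
Proof. by move=> y01; rewrite -eq_frac => /eqP ->; rewrite frac_id. Qed.

Lemma int_small x : x \is a Num.int -> `|x| < 1 -> x = 0.
Proof.
move=> xz x1; apply/eqP; apply: contraTT x1 => x0.
by rewrite -leNgt norm_intr_ge1.
Qed.

(** Otherwise the 0-1 indicator of [P] would be continuous and take the value 1/2. This is how local
    statements are propagated along lines, leaves and strips. *)
Lemma locally_constant_itv (P : R -> Prop) (a b : R) :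
  (forall x, a < x < b -> \forall y \near x, P y <-> P x) ->
  forall x y, a < x < b -> a < y < b -> P x -> P y.
Proof.
move=> Ploc x y xab yab Px; apply: contrapT => nPy.
pose f (t : R) : R := if `[< P t >] then 1 else 0.
have fc t : a < t < b -> {for t, continuous f}.
  move=> /Ploc Pt; apply: (@near_cst_continuous _ _ (f t)).
  by apply: filterS Pt => u Pu; rewrite /f; congr (if _ then _ else _); apply/asbool_equiv_eq.
have fx : f x = 1 by rewrite /f asboolT.
have fy : f y = 0 by rewrite /f asboolF.
have half0 : forall c, f c = 2^-1 -> False.
  by move=> c; rewrite /f; case: ifP => _; lra.
move: xab yab => /andP[? ?] /andP[? ?].
have [xy|yx] := leP x y.
  have [] := @IVT R f x y 2^-1 xy.
  - apply: continuous_in_subspaceT => t; rewrite inE/= in_itv/= => /andP[? ?].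
    by apply: fc; apply/andP; split; lra.
  - by rewrite fx fy; rewrite ge_min le_max; apply/andP; split; lra.
  - by move=> c _ /half0.
have [] := @IVT R f y x 2^-1 (ltW yx).
- apply: continuous_in_subspaceT => t; rewrite inE/= in_itv/= => /andP[? ?].
  by apply: fc; apply/andP; split; lra.
- by rewrite fx fy; rewrite ge_min le_max; apply/andP; split; lra.
- by move=> c _ /half0.
Qed.

End frac.

(** * The double cover of the torus *)

Section cover.
Context {R : realType}.
Variables alpha beta : R.
Implicit Types (z w u v h : cplx R) (b s : bool).

Definition xi z : R := Re z + Im z * alpha.
Definition lattice z := (xi z \is a Num.int) && (Im z \is a Num.int).
Definition slit z := (Im z \is a Num.int) && (0 < frac (xi z) < beta).
Definition branch z :=
  (Im z \is a Num.int) && ((frac (xi z) == 0) || (frac (xi z) == beta)).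
Definition branch_pt b : cplx R := (if b then beta else 0)%:C.

Lemma xiE z : xi z = Re z + Im z * alpha. Proof. by []. Qed.
Lemma latticeE z : lattice z = (xi z \is a Num.int) && (Im z \is a Num.int).
Proof. by []. Qed.
Lemma slitE z : slit z = (Im z \is a Num.int) && (0 < frac (xi z) < beta).
Proof. by []. Qed.
Lemma branchE z : branch z =
  (Im z \is a Num.int) && ((frac (xi z) == 0) || (frac (xi z) == beta)).
Proof. by []. Qed.

Lemma xiD z w : xi (z + w) = xi z + xi w.
Proof. by rewrite /xi !cplxE; ring. Qed.
Lemma xiN z : xi (- z) = - xi z.
Proof. by rewrite /xi !cplxE; ring. Qed.

Lemma xi_inj z w : xi z = xi w -> Im z = Im w -> z = w.
Proof. by move=> zw Imzw; apply/cplx_eqP; split=> //; move: zw; rewrite /xi Imzw; lra. Qed.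

Lemma lattice0 : lattice 0.
Proof. by rewrite /lattice /xi /= mul0r addr0 rpred0. Qed.
Lemma latticeD z w : lattice z -> lattice w -> lattice (z + w).
Proof.
by rewrite /lattice xiD ImD => /andP[? ?] /andP[? ?]; apply/andP; split; rewrite rpredD.
Qed.
Lemma latticeN z : lattice (- z) = lattice z.
Proof. by rewrite /lattice xiN ImN !rpredN. Qed.
Lemma latticeC z w : lattice (z - w) = lattice (w - z).
Proof. by rewrite -latticeN opprB. Qed.

Lemma lattice_small z : lattice z -> `|xi z| < 1 -> `|Im z| < 1 -> z = 0.
Proof.
move=> /andP[xz yz] x1 y1; apply: xi_inj.
  by rewrite (int_small xz x1) /xi /= mul0r addr0.
by rewrite (int_small yz y1).
Qed.

Lemma lattice_small_Re z : lattice z -> `|Re z| < 1 -> `|Im z| < 1 -> z = 0.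
Proof.
move=> lz x1 y1; apply: (lattice_small lz) => //.
have /andP[_ yz] := lz.
by rewrite /xi (int_small yz y1) mul0r addr0.
Qed.

Lemma lattice_frac z w : lattice (z - w) ->
  frac (xi z) = frac (xi w) /\ (Im z \is a Num.int) = (Im w \is a Num.int).
Proof.
rewrite /lattice xiD xiN ImD ImN => /andP[x y]; split.
  by apply/eqP; rewrite eq_frac.
by rewrite -[in LHS](subrK (Im w) (Im z)) rpredDl.
Qed.

Lemma slit_lattice z w : lattice (z - w) -> slit z = slit w.
Proof. by move=> /lattice_frac[x y]; rewrite /slit x y. Qed.
Lemma branch_lattice z w : lattice (z - w) -> branch z = branch w.
Proof. by move=> /lattice_frac[x y]; rewrite /branch x y. Qed.

Definition reduce z : cplx R :=
  (frac (xi z) - frac (Im z) * alpha) +i* frac (Im z).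

Lemma xi_reduce z : xi (reduce z) = frac (xi z).
Proof. by rewrite /xi /reduce /= subrK. Qed.

Lemma reduce_lattice z : lattice (z - reduce z).
Proof.
by rewrite /lattice xiD xiN xi_reduce ImD ImN !sub_frac_int.
Qed.

Lemma reduceP z w : reduce z = reduce w <-> lattice (z - w).
Proof.
split=> [e|].
  rewrite -(subrK (reduce z) z) -addrA latticeD ?reduce_lattice//.
  by rewrite e -opprB latticeN reduce_lattice.
rewrite /lattice xiD xiN ImD ImN -!eq_frac => /andP[/eqP x /eqP y].
by rewrite /reduce x y.
Qed.

(** Resetting the sheet at a branch point identifies the two sheets there. The map is idempotent, so
    its fixed points serve as the quotient. *)
Definition normal_form (a : cplx R * bool) := (reduce a.1, a.2 && ~~ branch a.1).

Lemma normal_formK a : normal_form (normal_form a) == normal_form a.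
Proof.
rewrite /normal_form /= -(branch_lattice (reduce_lattice _)) -andbA andbb.
apply/eqP; congr (_, _); apply/reduceP.
by rewrite latticeC reduce_lattice.
Qed.

Definition cover := {a : cplx R * bool | normal_form a == a}.
HB.instance Definition _ := Choice.on cover.

Definition pt z s : cover := exist _ (normal_form (z, s)) (normal_formK (z, s)).

Lemma pt_eqP z s w t :
  pt z s = pt w t <-> lattice (z - w) /\ (branch z \/ s = t).
Proof.
split.
  move=> /(congr1 val) e.
  have /reduceP zw : reduce z = reduce w := congr1 fst e.
  have /= := congr1 snd e.
  rewrite -(branch_lattice zw); case: (branch z); first by split=> //; left.
  by rewrite !andbT => ->; split=> //; right.
move=> [zw bst]; apply: val_inj; rewrite /= /normal_form /=.
rewrite -(branch_lattice zw) ((reduceP z w).2 zw).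
by case: bst => [->|->]; rewrite ?andbF.
Qed.

Lemma pt_surj q : exists z s, [/\ q = pt z s, 0 <= xi z < 1 & 0 <= Im z < 1].
Proof.
case: q => -[z s] e; exists (reduce z), s; split.
- apply: val_inj; apply: (etrans (esym (eqP e))); rewrite /= /normal_form /=.
  rewrite (branch_lattice (reduce_lattice z)); congr (_, _).
  by apply/reduceP; exact: reduce_lattice.
- by rewrite xi_reduce frac_ge0 frac_lt1.
- by rewrite /= frac_ge0 frac_lt1.
Qed.

Definition sing (q : cover) := exists z s, q = pt z s /\ branch z.

Lemma sing_pt z s : sing (pt z s) <-> branch z.
Proof.
by split=> [[w [t [/pt_eqP[zw _]]]]|]; [rewrite (branch_lattice zw)|exists z, s].
Qed.

(* The sheet of the point at coordinate u around a branch point: it changes when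
   u ^ 2 crosses the slit, which leaves 0 to the right and beta to the left. *)
Definition sheet b u :=
  if b then (0 < Re u) || (Re u == 0) && (0 <= Im u)
  else (0 < Im u) || (Im u == 0) && (0 <= Re u).

(* Near a regular point pt z s the flat coordinate is z, and going down through
   the slit changes sheets: the points of the slit itself count as above it.
   Near a branch point the coordinate is a square root u of z - branch_pt b. *)
Definition germ_open (V : set cover) :=
  (forall z s, ~~ branch z -> V (pt z s) ->
     \forall h \near (0 : cplx R), V (pt (z + h) (s (+) (slit z && (Im h < 0))))) /\
  (forall b s, V (pt (branch_pt b) s) ->
     \forall u \near (0 : cplx R), V (pt (branch_pt b + u ^+ 2) (sheet b u))).

Lemma germ_openT : germ_open setT.
Proof. by split=> [z s _ _|b s _]; exact: filterE. Qed.

Lemma germ_openI : setI_closed germ_open.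
Proof.
move=> V W [V1 V2] [W1 W2]; split.
  move=> z s zb [Vz Wz].
  by apply: filterS2 (V1 z s zb Vz) (W1 z s zb Wz) => h; split.
move=> b s [Vb Wb].
by apply: filterS2 (V2 b s Vb) (W2 b s Wb) => h; split.
Qed.

Lemma germ_open_bigU (I : Type) (f : I -> set cover) :
  (forall i, germ_open (f i)) -> germ_open (\bigcup_i f i).
Proof.
move=> fo; split.
  move=> z s zb [i _ fi].
  by apply: filterS ((fo i).1 z s zb fi) => h fh; exists i.
move=> b s [i _ fi].
by apply: filterS ((fo i).2 b s fi) => h fh; exists i.
Qed.

HB.instance Definition _ := isOpenTopological.Build cover
  germ_openT germ_openI germ_open_bigU.

End cover.

Ltac alra := apply/andP; split; lra.

(** * Neighbourhoods of the branch points *)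

Section branch_disk.
Context {R : realType}.
Variables alpha beta : R.
Hypothesis beta01 : 0 < beta < 1.
Let beta_gt0 : 0 < beta. Proof. by case/andP : beta01. Qed.
Let beta_lt1 : beta < 1. Proof. by case/andP : beta01. Qed.
Implicit Types (z w u v h : cplx R) (b s : bool).

Local Notation xi := (xi alpha).
Local Notation lattice := (lattice alpha).
Local Notation slit := (slit alpha beta).
Local Notation branch := (branch alpha beta).
Local Notation branch_pt := (branch_pt beta).

(** The distance from 0 to [beta] mod 1: a box of half-side [rho] about a branch point contains no
    other one. *)
Let rho := Num.min beta (1 - beta).

Lemma xi_branch_pt b : xi (branch_pt b) = if b then beta else 0.
Proof. by rewrite xiE /= mul0r addr0. Qed.

Lemma branchP z : branch z <-> exists b, lattice (z - branch_pt b).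
Proof.
have ? := beta_gt0; have ? := beta_lt1.
have fb : frac beta = beta by apply: frac_id; alra.
have f0 : frac 0 = 0 :> R by apply: frac_id; rewrite lexx ltr01.
have b0 b : branch (branch_pt b).
  rewrite branchE xi_branch_pt /= rpred0 /=.
  by case: b; rewrite ?fb ?f0 eqxx ?orbT.
split=> [/andP[yz]|[b /branch_lattice ->//]].
move=> /orP[|] /eqP x; [exists false|exists true];
  by rewrite latticeE xiD xiN xi_branch_pt -eq_frac ?fb ?f0 x eqxx /= ImD ImN /= oppr0 addr0.
Qed.

Lemma branch_pt_branch b : branch (branch_pt b).
Proof. by apply/branchP; exists b; rewrite subrr lattice0. Qed.

Lemma branch_ptK b c : lattice (branch_pt b - branch_pt c) -> b = c.
Proof.
have ? := beta_gt0; have ? := beta_lt1.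
move=> l; have /eqP : branch_pt b - branch_pt c = 0.
  apply: (lattice_small_Re l); rewrite !cplxE /=; last by rewrite subr0 normr0.
  by case: b c {l} => -[]; rewrite ltr_norml; alra.
rewrite subr_eq0 => /eqP/cplx_eqP[/=].
by case: b c {l} => -[] //; lra.
Qed.

Definition near_branch h := `|Re h| < rho /\ `|Im h| < rho.

Lemma near_branchE h : near_branch h = (`|Re h| < rho /\ `|Im h| < rho).
Proof. by []. Qed.

Lemma branch_near_branch b h : near_branch h ->
  branch (branch_pt b + h) -> h = 0.
Proof.
rewrite /near_branch /rho !lt_min !ltr_norml => -[].
move=> /andP[/andP[? ?] /andP[? ?]] /andP[/andP[? ?] /andP[? ?]].
have ? := beta_gt0; have ? := beta_lt1.
move=> /branchP[c l].
have H : branch_pt b + h - branch_pt c = 0.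
  apply: (lattice_small_Re l); rewrite !cplxE /= ltr_norml;
    by case: b c {l} => -[]; alra.
have /cplx_eqP[] := H; rewrite !cplxE /= => hR hI.
apply/cplx_eqP => /=; move: hR hI.
by case: b c {l H} => -[]; split; lra.
Qed.

Lemma slit_near_branch b h : near_branch h ->
  slit (branch_pt b + h) =
  (Im h == 0) && (if b then Re h < 0 else 0 < Re h).
Proof.
rewrite /near_branch /rho !lt_min !ltr_norml => -[].
move=> /andP[/andP[? ?] /andP[? ?]] /andP[/andP[? ?] /andP[? ?]].
have ? := beta_gt0; have ? := beta_lt1.
rewrite slitE xiD xi_branch_pt ImD /= add0r.
have -> : (Im h \is a Num.int) = (Im h == 0).
  apply/idP/eqP => [yz|->]; last exact: rpred0.
  by apply: int_small => //; rewrite ltr_norml; alra.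
have [y0|//] := eqVneq (Im h) 0.
rewrite xiE y0 mul0r addr0 /=.
case: b.
  by rewrite frac_id; [apply/idP/idP; lra|alra].
rewrite add0r; have [x0|x0] := ltP 0 (Re h).
  by rewrite frac_id; [lra|alra].
have [->|x1] := eqVneq (Re h) 0; first by rewrite frac_id ?ltxx//; alra.
(* To the left of 0 the fractional part exceeds [beta], because [Re h] is greater than
   [beta - 1]. *)
have -> /= : frac (Re h) = Re h + 1.
  apply: frac_uniq; first by alra.
  by rewrite opprD addrA subrr add0r rpredN rpred1.
by apply/negbTE; rewrite negb_and -!leNgt; apply/orP; right; lra.
Qed.

(** This separates the two square roots of a plane point and so makes the branch chart injective. *)
Lemma sheetN b u : u != 0 -> sheet b (- u) = ~~ sheet b u.
Proof.
case: u => x y; rewrite /sheet eq_complex /= !oppr_gt0 !oppr_ge0 !oppr_eq0.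
by case: b; case: (ltrgtP x 0); case: (ltrgtP y 0).
Qed.

Lemma near_same_sign (x : R) : x != 0 -> \forall e \near 0^'+, forall y, `|y - x| < e ->
  (0 < y) = (0 < x) /\ (y == 0) = false.
Proof.
move=> x0; near=> e => y.
have ex : e < `|x| by near: e; apply: nbhs_right_lt; rewrite normr_gt0.
move=> yx; have {yx ex} : `|y - x| < `|x| by exact: lt_trans ex.
rewrite ltr_norml => /andP[].
case/orP: (lt_total x0) => xs; [rewrite ltr0_norm//|rewrite gtr0_norm//] => ? ?.
  have ys : y < 0 by lra.
  by rewrite (lt_gtF ys) (lt_gtF xs) (lt_eqF ys).
have ys : 0 < y by lra.
by rewrite ys xs (gt_eqF ys).
Unshelve. all: by end_near. Qed.

(** Compatibility of the two rules of [germ_open]. Squaring sends one coordinate axis to the line of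
    the slit on the slit's side. At a point of that axis one coordinate of v keeps its sign, and the
    sign of the other, which [sheet] reads, is decided by that of Im (v^2) = 2 Re v Im v. *)
Lemma sheet_near b u : u != 0 -> near_branch (u ^+ 2) ->
  \forall v \near u, sheet b v =
    sheet b u (+) (slit (branch_pt b + u ^+ 2) && (Im (v ^+ 2 - u ^+ 2) < 0)).
Proof.
move=> u0 /slit_near_branch ->.
have [e e0 [eR eI]] : exists2 e : R, 0 < e &
    (Re u != 0 -> forall y, `|y - Re u| < e -> (0 < y) = (0 < Re u) /\ (y == 0) = false) /\
    (Im u != 0 -> forall y, `|y - Im u| < e -> (0 < y) = (0 < Im u) /\ (y == 0) = false).
  have H (x : R) : exists2 e : R, 0 < e & (x != 0 -> forall y, `|y - x| < e ->
      (0 < y) = (0 < x) /\ (y == 0) = false).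
    have [->|x0] := eqVneq x 0; first by exists 1.
    have [e /andP[e0 eP]] : exists e : R, (0 < e) && `[< forall y,
        `|y - x| < e -> (0 < y) = (0 < x) /\ (y == 0) = false >].
      near (0 : R)^'+ => e; exists e; apply/andP; split=> //.
      by apply/asboolP; near: e; exact: near_same_sign.
    by exists e => // _; apply/asboolP.
  have [e1 e10 H1] := H (Re u); have [e2 e20 H2] := H (Im u).
  exists (Num.min e1 e2); first by rewrite lt_min e10.
  by split=> [/H1|/H2] {}H y; rewrite lt_min => /andP[? ?]; exact: H.
apply/nbhs_boxP; exists e => // v vR vI.
move: u0; rewrite eq_complex /= ImD ImN !Im_sqr Re_sqr /sheet.
move: eR eI vR vI; set x := Re u; set y := Im u; set x' := Re v; set y' := Im v.
move=> eR eI vR vI.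
have [x0|x0] := eqVneq x 0; have [y0|y0] := eqVneq y 0 => //= _.
- have [y'y y'0] := eI y0 _ vI.
  rewrite x0 mul0r mulr0 eqxx subr0 expr0n sub0r oppr_gt0 oppr_lt0 ltxx /=.
  rewrite [y ^+ 2 < 0]ltNge sqr_ge0 /= exprn_even_gt0// y0 pmulr_rlt0// y'0.
  case: b; last by rewrite /= ?(negbTE y0) ?orbF ?y'y ?addbF.
  case/orP: (lt_total y0) => ys.
    have y'n : y' < 0 by move: y'y y'0; rewrite (lt_gtF ys); case: (ltrgtP y').
    by rewrite ![0 <= _]leNgt ys y'n nmulr_llt0// andbF orbF.
  have y'p : 0 < y' by rewrite y'y.
  by rewrite !ltW//= pmulr_llt0//; case: (ltrgtP x').
- have [x'x x'0] := eR x0 _ vR.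
  rewrite y0 mulr0 mulr0 eqxx subr0 expr0n subr0 ltxx /=.
  rewrite exprn_even_gt0// x0 [x ^+ 2 < 0]ltNge sqr_ge0 /= pmulr_rlt0// x'0.
  case: b; first by rewrite /= x'x ?(negbTE x0) ?orbF ?addbF.
  case/orP: (lt_total x0) => xs.
    have x'n : x' < 0 by move: x'x x'0; rewrite (lt_gtF xs); case: (ltrgtP x').
    by rewrite ![0 <= _]leNgt xs x'n nmulr_rlt0// andbF orbF.
  have x'p : 0 < x' by rewrite x'x.
  by rewrite !ltW//= pmulr_rlt0//; case: (ltrgtP y').
- have [-> ->] := eR x0 _ vR; have [-> ->] := eI y0 _ vI.
  by rewrite !mulf_eq0 pnatr_eq0 (negbTE x0) (negbTE y0) addbF.
Unshelve. all: by end_near. Qed.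

End branch_disk.

(** * Charts *)

Section charts.
Context {R : realType}.
Variables alpha beta : R.
Hypothesis beta01 : 0 < beta < 1.
Implicit Types (z w u v h : cplx R) (b s : bool) (k : option bool)
  (D : set (cplx R)) (sg : cplx R -> bool).

Local Notation slit := (slit alpha beta).
Local Notation branch := (branch alpha beta).
Local Notation branch_pt := (branch_pt beta).
Local Notation cover := (cover alpha beta).
Local Notation pt := (pt alpha beta).
Local Notation near_branch := (near_branch beta).

(* None stands for a regular chart, Some b for the branch chart at
   branch_pt b. *)
Definition coord k u : cplx R := if k is Some b then branch_pt b + u ^+ 2 else u.
Definition slope k u v : cplx R := if k is Some _ then v + u else 1.

(** [slope] is the divided difference of [coord]; on the diagonal it is the derivative, hence the
    coefficient of the form dz in the chart. *)
Lemma coord_sub k u v : coord k v - coord k u = (v - u) * slope k u v.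
Proof.
case: k => [b|] /=; last by rewrite mulr1.
by rewrite opprD addrACA subrr add0r subr_sqr.
Qed.

Lemma slope_continuous k u : {for u, continuous (slope k u)}.
Proof.
case: k => [b|]; last exact: cst_continuous.
rewrite /slope; apply: (@continuousD _ _ _ (fun v : cplx R => v) (fun=> u)).
  exact: cvg_id.
exact: cst_continuous.
Qed.

Lemma coord_near k u (P : set (cplx R)) : (\forall h \near (0 : cplx R), P h) ->
  \forall v \near u, P (coord k v - coord k u).
Proof.
move=> P0.
have H : {for u, continuous (fun v => (v - u) * slope k u v)}.
  apply: (@continuousM _ _ (fun v => v - u) (slope k u)); last exact: slope_continuous.
  apply: (@continuousB _ _ _ (fun v : cplx R => v) (fun=> u)).
    exact: cvg_id.
  exact: cst_continuous.
have : nbhs ((u - u) * slope k u u) P by rewrite subrr mul0r.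
move=> /H Hu.
have {}Hu : \forall v \near u, P ((v - u) * slope k u v) := Hu.
by apply: filterS Hu => v; rewrite coord_sub.
Qed.

Lemma coord_open k u (W : set (cplx R)) : nbhs u W ->
  \forall h \near (0 : cplx R), exists2 v, W v & coord k v = coord k u + h.
Proof.
case: k => [b|] /=.
  move=> /sqrt_near; apply: filterS => h [v Wv vE].
  by exists v => //; rewrite vE addrA.
move=> /(near0P u W).1; apply: filterS => h Wh.
by exists (u + h).
Qed.

(** The function [sg] selects the sheet, and [good_germ] makes it obey the crossing rule of
    [germ_open]. At each branch point [good_branch] admits a single chart, so that a transition at a
    singularity is the identity. *)
Record good_chart k D sg : Prop := GoodChart {
  good_open : open D;
  good_inj : forall u v, D u -> D v ->
    pt (coord k u) (sg u) = pt (coord k v) (sg v) -> u = v;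
  good_germ : forall u, D u -> ~~ branch (coord k u) ->
    \forall v \near u, sg v = sg u (+)
      (slit (coord k u) && (Im (coord k v - coord k u) < 0));
  good_branch : if k is Some b then D = [set u | near_branch (u ^+ 2)] /\ sg = sheet b
                else forall u, D u -> ~~ branch u }.

Lemma good_branchP k D sg u : good_chart k D sg -> D u ->
  branch (coord k u) <-> k <> None /\ u = 0.
Proof.
move=> gD Du; case: k gD => [b|] gD /=; last first.
  by split=> [bu|[//]]; have := good_branch gD u Du; rewrite bu.
have [DE _] := good_branch gD; move: Du; rewrite DE => Du.
split=> [/(branch_near_branch beta01 Du)/eqP|[_ ->]].
  by rewrite expf_eq0 => /andP[_ /eqP].
by rewrite expr0n addr0 branch_pt_branch.
Qed.

Lemma good_near k D sg u (V : set cover) : good_chart k D sg -> open V -> D u ->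
  V (pt (coord k u) (sg u)) -> \forall v \near u, V (pt (coord k v) (sg v)).
Proof.
move=> gD [Vreg Vbr] Du Vu.
have [bu|bu] := boolP (branch (coord k u)).
  have /(good_branchP gD Du)[k0 u0] := bu.
  case: k gD bu Vu k0 => [b|] gD _ + k0; last by case: k0.
  have [DE ->] := good_branch gD.
  by rewrite u0 /= expr0n addr0 => /Vbr.
have := Vreg _ _ bu Vu => /(coord_near k u).
move: (good_germ gD Du bu); apply: filterS2 => v ->.
by rewrite addrC subrK.
Qed.

(** Nearby plane points lift to the chart by [coord_open], and [good_germ] puts the lift on the
    sheet that [germ_open] prescribes. *)
Lemma good_image_open k D sg (W : set (cplx R)) : good_chart k D sg ->
  open W -> W `<=` D -> open [set pt (coord k u) (sg u) | u in W].
Proof.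
move=> gD oW WD; split.
  move=> z s zb [u Wu /pt_eqP[uz]].
  have Du := WD _ Wu.
  have bu : ~~ branch (coord k u) by rewrite (branch_lattice beta uz).
  case=> [bu'|us]; first by rewrite bu' in bu.
  have Wg : nbhs u (W `&` [set v | sg v = sg u (+)
      (slit (coord k u) && (Im (coord k v - coord k u) < 0))]).
    by apply: filterI; [exact: open_nbhs_nbhs (conj oW Wu)|exact: (good_germ gD Du bu)].
  apply: filterS (coord_open k Wg) => h [v [Wv gv] vE].
  exists v => //; apply/pt_eqP; split; first by rewrite vE opprD addrACA subrr addr0.
  right; rewrite gv us (slit_lattice beta uz) vE.
  by rewrite [coord k u + h]addrC addrK.
move=> b s [u Wu /pt_eqP[ub _]].
have Du := WD _ Wu.
have /(good_branchP gD Du)[k0 u0] : branch (coord k u).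
  by rewrite (branch_lattice beta ub) branch_pt_branch.
case: k gD ub k0 => [c|] gD + k0; last by case: k0.
have [DE sgE] := good_branch gD.
rewrite u0 /= expr0n addr0 => /(branch_ptK beta01) <-.
have : nbhs u W by exact: open_nbhs_nbhs (conj oW Wu).
by rewrite u0; apply: filterS => v Wv; exists v => //; rewrite sgE.
Qed.

Definition chart_of D (psi : cplx R -> cover) : local_param R cover :=
  LocalParam (psi @` D) (fun q => xget 0 [set u | D u /\ psi u = q]).

Definition cover_chart k D sg := chart_of D (fun u => pt (coord k u) (sg u)).

Section one_chart.
Variables (k : option bool) (D : set (cplx R)) (sg : cplx R -> bool).
Hypothesis gD : good_chart k D sg.
Let psi u := pt (coord k u) (sg u).
Local Notation c := (cover_chart k D sg).

Lemma chartK u : D u -> c (psi u) = u.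
Proof.
move=> Du; rewrite /=; case: xgetP => [_ -> [Dv /(good_inj gD) ]|]; first exact.
by move=> /(_ u) [].
Qed.

Lemma good_is_chart : is_chart c.
Proof.
have odom : open (dom c) by apply: good_image_open gD (good_open gD) _.
split=> //.
- apply: continuous_in_subspaceT => p /set_mem[u Du <-] W.
  rewrite -/(psi u) chartK// => Wu.
  have oWD : nbhs u (W^° `&` D).
    by apply: filterI; [exact: nbhs_interior|exact: open_nbhs_nbhs (conj (good_open gD) Du)].
  have := good_image_open gD (openI (open_interior W) (good_open gD)) (@subIsetr _ _ _).
  move=> oI; apply: (@filterS _ _ _ [set pt (coord k v) (sg v) | v in W^° `&` D]).
    by move=> _ [v [/interior_subset Wv Dv] <-]; change (W (c (psi v))); rewrite chartK.
  by apply: open_nbhs_nbhs; split => //; exists u => //; exact: nbhs_singleton oWD.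
- move=> p q /set_mem[u Du <-] /set_mem[v Dv <-] e.
  have uv : u = v := etrans (esym (chartK Du)) (etrans e (chartK Dv)).
  by rewrite uv.
move=> V oV Vc.
rewrite openE => _ [p Vp <-].
have [u Du uE] := Vc _ Vp; rewrite -uE -/(psi u) chartK//.
have : nbhs u D by exact: open_nbhs_nbhs (conj (good_open gD) Du).
have : \forall v \near u, V (psi v) by apply: (good_near gD) => //; rewrite uE.
rewrite /interior /=; apply: filterS2 => v Vv Dv.
by exists (psi v) => //; exact: chartK.
Qed.

Lemma chart_inv u p : D u -> param_inv c p u = psi u.
Proof.
move=> Du; rewrite -[in LHS](chartK Du); apply: pinvKV; last by rewrite inE; exists u.
by have [] := good_is_chart.
Qed.

End one_chart.

End charts.

(** * Transition maps *)

Section transition.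
Context {R : realType}.
Variables alpha beta : R.
Hypothesis beta01 : 0 < beta < 1.
Implicit Types (z w u v h : cplx R) (b s : bool) (k : option bool)
  (D : set (cplx R)) (sg : cplx R -> bool).

Local Notation slit := (slit alpha beta).
Local Notation branch := (branch alpha beta).
Local Notation cover := (cover alpha beta).
Local Notation pt := (pt alpha beta).
Local Notation coord := (coord beta).
Local Notation slope := (@slope R).
Local Notation good_chart := (good_chart alpha beta).
Local Notation cover_chart := (@cover_chart R alpha beta).

Lemma coord_derivative_uniq (c : local_param R cover) p (f : cover -> cplx R) a a' :
  has_coord_derivative c p f a -> has_coord_derivative c p f a' -> a = a'.
Proof. by move=> [_ <-] [_ <-]. Qed.

Lemma slope_neq0 k u : ~~ branch (coord k u) -> slope k u u != 0.
Proof.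
case: k => [b|] /=; last by rewrite oner_eq0.
rewrite -mulr2n mulrn_eq0 /=; apply: contraNneq => ->.
by rewrite expr0n addr0 branch_pt_branch.
Qed.

(** Away from branch points both charts follow the same plane coordinate up to a lattice vector and
    change sheets by the same rule. Letting [W] shrink gives continuity of the transition;
    [W = setT] gives the equality of increments. *)
Lemma good_lift k D sg k' D' sg' u u' : good_chart k D sg -> good_chart k' D' sg' ->
  D u -> D' u' -> pt (coord k u) (sg u) = pt (coord k' u') (sg' u') ->
  ~~ branch (coord k u) ->
  forall W : set (cplx R), nbhs u' W -> \forall v \near u, exists v',
    [/\ W v', D' v', coord k' v' - coord k' u' = coord k v - coord k u &
        pt (coord k v) (sg v) = pt (coord k' v') (sg' v')].
Proof.
move=> gD gD' Du Du' /pt_eqP[uu' uu's] bu W Wu'.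
have bu' : ~~ branch (coord k' u') by rewrite -(branch_lattice beta uu').
have us : sg u = sg' u' by case: uu's => // H; rewrite H in bu.
have oD' : nbhs u' D' by exact: open_nbhs_nbhs (conj (good_open gD') Du').
pose W' := [set v' | [/\ W v', D' v' & sg' v' = sg' u' (+)
  (slit (coord k' u') && (Im (coord k' v' - coord k' u') < 0))]].
have Wu'' : nbhs u' W'.
  move: (good_germ gD' Du' bu'); apply: filterS2 (filterI Wu' oD') => v [].
  by split.
have H : \forall v \near u, exists2 v', W' v' &
    coord k' v' = coord k' u' + (coord k v - coord k u).
  exact: (coord_near beta k u (coord_open beta k' Wu'')).
apply: filterS2 (good_germ gD Du bu) H => v sv.
move=> [v' [Wv' Dv' sv'] v'E]; exists v'; split=> //.
  by rewrite v'E addrAC subrr add0r.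
apply/pt_eqP; split.
  rewrite v'E (_ : _ - _ = coord k u - coord k' u')//; ring.
right; rewrite sv sv' us v'E (slit_lattice beta uu').
by rewrite [coord k' u' + _]addrC addrK.
Qed.

Lemma good_transition k D sg k' D' sg' u u' :
  good_chart k D sg -> good_chart k' D' sg' -> D u -> D' u' ->
  pt (coord k u) (sg u) = pt (coord k' u') (sg' u') ->
  exists2 a, has_coord_derivative (cover_chart k D sg) (pt (coord k u) (sg u))
      (cover_chart k' D' sg') a &
    slope k u u = slope k' u' u' * a.
Proof.
move=> gD gD' Du Du' uu'.
rewrite /has_coord_derivative (chartK gD Du).
set c := cover_chart k D sg; set e := cover_chart k' D' sg'.
set p := pt _ _; set f := (_ \o _).
have fE : \forall v \near u, f v = e (pt (coord k v) (sg v)).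
  apply: filterS (open_nbhs_nbhs (conj (good_open gD) Du)) => v Dv.
  by rewrite /f /= (chart_inv beta01 gD).
have fu : f u = u'.
  by rewrite (nbhs_singleton fE) uu' (chartK gD' Du').
have [bu|bu] := boolP (branch (coord k u)).
  have bu' : branch (coord k' u').
    by move/pt_eqP : uu' => [uu' _]; rewrite -(branch_lattice beta uu').
  have [k0 u0] := (good_branchP beta01 gD Du).1 bu.
  have [k0' u0'] := (good_branchP beta01 gD' Du').1 bu'.
  (* Both slopes vanish at a singularity and do not determine the derivative; it is 1 because the
     two charts coincide. *)
  have [kk' DD' ss'] : [/\ k = k', D = D' & sg = sg'].
    move/pt_eqP : uu' => [+ _]; rewrite u0 u0'.
    case: (k) gD k0 => // b gDb _; case: (k') gD' k0' => // b' gDb' _ /=.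
    rewrite !expr0n !addr0 => /(branch_ptK beta01) bb; subst b'.
    have [-> ->] := good_branch gDb; have [-> ->] := good_branch gDb'; by split.
  subst k' D' sg'; exists 1; last by rewrite mulr1 u0 u0'.
  apply: (@derive_caratheodory _ f (fun=> 1)); first exact: cst_continuous.
  have oD : nbhs u D := open_nbhs_nbhs (conj (good_open gD) Du).
  apply: filterS2 fE oD => v -> Dv.
  by rewrite fu mulr1 (chartK gD) // u0 u0'.
have bu' : ~~ branch (coord k' u').
  by move/pt_eqP : (uu') => [uu'l _]; rewrite -(branch_lattice beta uu'l).
have s0 := slope_neq0 bu'.
have lift := good_lift gD gD' Du Du' uu' bu.
have fc : {for u, continuous f}.
  move=> W; rewrite fu => /lift Wl.
  have : \forall v \near u, W (f v).
    apply: filterS2 Wl fE => v [v' [Wv' Dv' _ vv']] ->.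
    by rewrite vv' (chartK gD' Dv').
  by [].
exists (slope k u u / slope k' u' u'); last by rewrite mulrC divfK.
(* Equating the increments of the plane coordinate in the two charts gives (v - u) slope k u v = (f
   v - u') slope k' u' (f v), so [K] is the Carathéodory factor. *)
pose K v := slope k u v / slope k' u' (f v).
have -> : slope k u u / slope k' u' u' = K u by rewrite /K fu.
have sc : {for u, continuous (fun v => slope k' u' (f v))}.
  move=> W WH.
  have H : nbhs (f u) (slope k' u' @^-1` W).
    by move: WH; rewrite fu => WH; exact: (@slope_continuous _ k' u' _ WH).
  exact: (fc _ H).
apply: derive_caratheodory.
  apply: (@continuousM _ _ (slope k u) (fun v => (slope k' u' (f v))^-1)).
    exact: slope_continuous.
  by apply: continuousV => //; rewrite fu.
have sn0 : \forall v \near u, slope k' u' (f v) != 0.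
  have H : nbhs (slope k' u' (f u)) [set w : cplx R | w != 0].
    by rewrite fu; exact: near_neq0.
  exact: (sc _ H).
have dE : \forall v \near u, coord k' (f v) - coord k' u' = coord k v - coord k u.
  apply: filterS2 (lift setT filterT) fE => v [v' [_ Dv' vE vv']] ->.
  by rewrite vv' (chartK gD' Dv').
apply: filterS2 sn0 dE => v v0; rewrite !coord_sub fu => vE.
by rewrite /K mulrA -vE mulfK.
Qed.

End transition.

Section re_im.
Context {R : realType}.

Lemma Re_continuous : continuous (fun z : cplx R => Re z).
Proof.
move=> z A /nbhs_ballP[e /= e0 eA]; apply/nbhs_boxP; exists e => // w wR _.
by apply: eA; rewrite /ball /= distrC.
Qed.

Lemma Im_continuous : continuous (fun z : cplx R => Im z).
Proof.
move=> z A /nbhs_ballP[e /= e0 eA]; apply/nbhs_boxP; exists e => // w _ wI.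
by apply: eA; rewrite /ball /= distrC.
Qed.

Lemma near_addr (z : cplx R) (P : cplx R -> Prop) :
  (\forall w \near z, P w) -> exists2 e : R, 0 < e &
    forall d, `|d| < e -> P (z + d%:C) /\ P (z + d *i).
Proof.
move=> /near_boxP[e e0 eP]; exists e => // d de.
by split; apply: eP => //=; rewrite normr0.
Qed.

End re_im.

(** * Rectangle charts *)

Section rectangles.
Context {R : realType}.
Variables alpha beta : R.
Hypothesis beta01 : 0 < beta < 1.
Let beta_gt0 : 0 < beta. Proof. by case/andP : beta01. Qed.
Let beta_lt1 : beta < 1. Proof. by case/andP : beta01. Qed.
Implicit Types (z w u v h : cplx R) (b s : bool).

Local Notation xi := (xi alpha).
Local Notation lattice := (lattice alpha).
Local Notation slit := (slit alpha beta).
Local Notation branch := (branch alpha beta).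
Local Notation cover := (cover alpha beta).
Local Notation good_chart := (good_chart alpha beta).

(* Rectangles whose translates by the lattice cover the regular points: the
   first two lie above the slit, the last two straddle the line Im z = 0, one
   of them across the slit. *)
Definition rect_lo n : R := nth 0 [:: 0; 2^-1; 0; beta] n.
Definition rect_hi n : R := nth 0 [:: 1; 2^-1 + 1; beta; 1] n.
Definition rect_bot n : R := if (n < 2)%N then 0 else - 2^-1.
Definition rect n : set (cplx R) := [set z |
  rect_lo n < Re z < rect_hi n /\ rect_bot n < Im z < rect_bot n + 1].
(** Rectangle 2 crosses the slit: [s] names the sheet of its upper half. *)
Definition rect_sheet n s z := s (+) ((n == 2)%N && (Im z < 0)).

Lemma rect_open n : open (rect n).
Proof.
have -> : rect n = (fun z : cplx R => Re z) @^-1` `]rect_lo n, rect_hi n[ `&`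
                   (fun z : cplx R => Im z) @^-1` `]rect_bot n, rect_bot n + 1[.
  by apply/seteqP; split=> z /=; rewrite !in_itv.
by apply: openI; (apply: open_comp; last exact: interval_open) => z _;
  [exact: Re_continuous|exact: Im_continuous].
Qed.

(** For n >= 4 both ends are the default 0 of [nth] and the rectangle is empty, so [n] can range
    over all naturals. *)
Lemma rect_width n : rect_hi n <= rect_lo n + 1.
Proof.
have ? := beta_gt0; have ? := beta_lt1.
by rewrite /rect_hi /rect_lo; case: n => [|[|[|[|n]]]] /=; rewrite ?nth_nil; lra.
Qed.

Lemma rect_inj n z w : rect n z -> rect n w -> lattice (z - w) -> z = w.
Proof.
move=> [/andP[? ?] /andP[? ?]] [/andP[? ?] /andP[? ?]] l.
have ? := rect_width n.
apply/eqP; rewrite -subr_eq0; apply/eqP.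
by apply: lattice_small_Re l _ _; rewrite !cplxE ltr_norml; alra.
Qed.

Lemma not_int (x : R) n : n%:~R < x < n%:~R + 1 -> (x \is a Num.int) = false.
Proof.
move=> /andP[nx xn]; apply/negP => xz.
have : x - n%:~R = 0 by apply: int_small; rewrite ?rpredB ?intr_int// ltr_norml; alra.
lra.
Qed.

Lemma not_int01 (x : R) : 0 < x < 1 -> (x \is a Num.int) = false.
Proof. by move=> x01; apply: (@not_int x 0); rewrite add0r. Qed.

Lemma rect_slit n z : rect n z ->
  ~~ branch z /\ slit z = (n == 2)%N && (Im z == 0).
Proof.
have ? := beta_gt0; have ? := beta_lt1.
move=> [Rez Imz]; have [n2|n2] := ltnP n 2.
  move: Imz; rewrite /rect_bot n2 add0r => /not_int01 yz.
  by rewrite branchE slitE yz /=; split=> //; case: n n2 {Rez} => [|[|]].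
have yz : (Im z \is a Num.int) = (Im z == 0) :> bool.
  move: Imz; rewrite /rect_bot ltnNge n2 /= => /andP[? ?].
  apply/idP/eqP => [yint|->]; last exact: rpred0.
  by apply: int_small => //; rewrite ltr_norml; alra.
have xiz : Im z == 0 -> frac (xi z) = Re z.
  move=> /eqP y0; rewrite xiE y0 mul0r addr0; apply: frac_id.
  by move: Rez; rewrite /rect_lo /rect_hi; case: n n2 {Imz} => [|[|[|[|n]]]] //= _;
    rewrite ?nth_nil => /andP[? ?]; alra.
rewrite branchE slitE yz; case: (Im z == 0) xiz => //= [xiz|_]; last by rewrite andbF.
rewrite xiz// andbT; move: Rez; rewrite /rect_lo /rect_hi.
case: n n2 {Imz} => [|[|[|[|n]]]] //= _; rewrite ?nth_nil => /andP[x0 x1].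
- by rewrite x0 x1 (gt_eqF x0) (lt_eqF x1).
- by rewrite (gt_eqF x0) (gt_eqF (lt_trans beta_gt0 x0)) (lt_gtF x0) andbF.
- lra.
Qed.

Lemma good_rect n s : good_chart None (rect n) (rect_sheet n s).
Proof.
split.
- exact: rect_open.
- by move=> u v /= uD vD /pt_eqP[l _]; exact: rect_inj uD vD l.
- move=> u uD _; rewrite /= (rect_slit uD).2 /rect_sheet.
  have [n2|n2] := eqVneq n 2%N; last by apply: filterE => v; rewrite /= !addbF.
  have [y0|y0|y0] /= := ltrgtP (Im u) 0.
  + have H : nbhs u [set v : cplx R | Im v < 0].
      apply: (@Im_continuous R u [set y | y < 0]).
      by apply: open_nbhs_nbhs; split=> //; exact: open_lt.
    by apply: filterS H => v vn; rewrite vn addbF.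
  + have H : nbhs u [set v : cplx R | 0 < Im v].
      apply: (@Im_continuous R u [set y | 0 < y]).
      by apply: open_nbhs_nbhs; split=> //; exact: open_gt.
    by apply: filterS H => v vp; rewrite (lt_gtF vp) !addbF.
  by apply: filterE => v; rewrite !addbF ImD ImN y0 subr0.
- by move=> u uD; have [] := rect_slit uD.
Qed.

Lemma rect_cover z : ~~ branch z -> exists n w, [/\ (n < 4)%N, rect n w & lattice (z - w)].
Proof.
have ? := beta_gt0; have ? := beta_lt1.
have [yz|yz _] := boolP (Im z \is a Num.int).
  rewrite branchE yz negb_or /= => /andP[x0 xb].
  have l : lattice (z - (frac (xi z))%:C).
    rewrite latticeE xiD xiN [xi _%:C]xiE /= mul0r addr0 sub_frac_int.
    by rewrite ImD ImN /= oppr0 addr0.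
  have xp : 0 < frac (xi z) by rewrite lt_def x0 frac_ge0.
  have xl : frac (xi z) < 1 := frac_lt1 _.
  have [xlb|xgb] := ltP (frac (xi z)) beta.
    exists 2%N, (frac (xi z))%:C; split=> //.
    by split=> /=; rewrite /rect_lo /rect_hi /rect_bot /=; alra.
  exists 3%N, (frac (xi z))%:C; split=> //.
  split=> /=; rewrite /rect_lo /rect_hi /rect_bot /=; last alra.
  by rewrite lt_def xb xgb.
have yp : 0 < frac (Im z).
  rewrite lt_def frac_ge0 andbT; apply: contra yz => /eqP y0.
  by rewrite -(subr0 (Im z)) -[X in _ - X]y0 sub_frac_int.
have yl : frac (Im z) < 1 := frac_lt1 _.
(* With m the floor of [Im z], adding the lattice vector (m alpha, -m) to [z] brings its height
   between 0 and 1 and its real part to [x]. *)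
pose x := Re z + (Num.floor (Im z))%:~R * alpha.
pose w j : cplx R := (frac x + j) +i* frac (Im z).
have wl j : j \is a Num.int -> lattice (z - w j).
  move=> jz; rewrite latticeE xiD xiN ImD ImN /= sub_frac_int andbT.
  rewrite (_ : _ - _ = (x - frac x) - j); first by rewrite rpredB ?sub_frac_int.
  have yE : frac (Im z) = Im z - (Num.floor (Im z))%:~R by [].
  rewrite !xiE /= yE /x; ring.
have xl : frac x < 1 := frac_lt1 _.
have [x0|x0] := eqVneq (frac x) 0.
  exists 1%N, (w 1); split=> //; last exact/wl/rpred1.
  split; rewrite /= /rect_lo /rect_hi /rect_bot /=; last by rewrite add0r yp.
  by rewrite x0; alra.
exists 0%N, (w 0); split=> //; last exact/wl/rpred0.
split; rewrite /= /rect_lo /rect_hi /rect_bot /= ?addr0 ?add0r ?yp//.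
by rewrite lt_def x0 frac_ge0.
Qed.

End rectangles.

(** * Topology of the surface *)

Section topology.
Context {R : realType}.
Variables alpha beta : R.
Hypothesis beta01 : 0 < beta < 1.
Implicit Types (z w u v h : cplx R) (b s : bool).

Local Notation xi := (xi alpha).
Local Notation lattice := (lattice alpha).
Local Notation slit := (slit alpha beta).
Local Notation branch := (branch alpha beta).
Local Notation branch_pt := (branch_pt beta).
Local Notation cover := (cover alpha beta).
Local Notation pt := (pt alpha beta).
Local Notation coord := (coord beta).
Local Notation rect := (rect beta).

Lemma xi_continuous : continuous xi.
Proof.
move=> z; apply: (@continuousD _ _ _ (fun z : cplx R => Re z) (fun z => Im z * alpha)).
  exact: Re_continuous.
apply: (@continuousM _ _ (fun z : cplx R => Im z) (fun=> alpha)).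
  exact: Im_continuous.
exact: cst_continuous.
Qed.

Lemma not_int_near (x : R) : x \isn't a Num.int ->
  exists2 e, 0 < e & forall d, `|d| < e -> x + d \isn't a Num.int.
Proof.
move=> xz; have x1 := frac_lt1 x; have x0 : 0 < frac x.
  rewrite lt_def frac_ge0 andbT; apply: contra xz => /eqP x0.
  by rewrite -(subr0 x) -[X in _ - X]x0 sub_frac_int.
exists (Num.min (frac x) (1 - frac x)); first by rewrite lt_min x0 subr_gt0.
move=> d; rewrite lt_min !ltr_norml => /andP[/andP[? ?] /andP[? ?]].
rewrite -(subrK (frac x) x) -addrA rpredDl ?sub_frac_int//.
by rewrite not_int01//; alra.
Qed.

Lemma lattice_closed z : ~~ lattice z -> \forall h \near (0 : cplx R), ~~ lattice (z + h).
Proof.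
have abs_near (f : cplx R -> R) e : continuous f -> f 0 = 0 -> 0 < e ->
    \forall h \near (0 : cplx R), `|f h| < e.
  move=> fc f0 e0; have H : nbhs (f 0) [set y : R | `|y| < e].
    apply/nbhs_ballP; exists e => // y; rewrite /ball /= f0.
    by rewrite sub0r normrN.
  exact: (fc _ _ H).
rewrite latticeE negb_and => /orP[] /not_int_near[e e0 eP].
  have H := abs_near xi e xi_continuous _ e0.
  apply: filterS (H _) => [h he|]; last by rewrite xiE /= mul0r addr0.
  by rewrite latticeE xiD (negbTE (eP _ he)).
have H := abs_near (fun z : cplx R => Im z) e (@Im_continuous R) (erefl _) e0.
apply: filterS H => h he.
by rewrite latticeE ImD (negbTE (eP _ he)) andbF.
Qed.

(** This is continuity of the projection to the torus, whose open sets appear as lattice-invariant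
    open sets of the plane. *)
Lemma pt_open (O : set (cplx R)) : open O ->
  (forall z w, lattice (z - w) -> O z -> O w) ->
  open [set pt z s | z in O & s in [set: bool]].
Proof.
move=> oO Olat; split.
  move=> z s _ [w Ow [t _] /pt_eqP[wz _]].
  have Oz : nbhs z O by apply: open_nbhs_nbhs; split=> //; exact: Olat Ow.
  move/near0P : Oz; apply: filterS => h Oh.
  by exists (z + h) => //; exists (s (+) (slit z && (Im h < 0))).
move=> b s [w Ow [t _] /pt_eqP[wb _]].
have Ob : nbhs (branch_pt b) O by apply: open_nbhs_nbhs; split=> //; exact: Olat Ow.
have Ob0 : \forall h \near (0 : cplx R), O (branch_pt b + h) by move/near0P : Ob.
have := coord_near beta (Some b) 0 Ob0.
apply: filterS => v Ov; exists (branch_pt b + v ^+ 2); last by exists (sheet b v).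
by move: Ov; rewrite /= expr0n addr0 addrAC subrr add0r.
Qed.

Definition lattice_box z (e : R) : set (cplx R) :=
  [set y | exists2 h : cplx R, `|Re h| < e /\ `|Im h| < e & lattice (y - z - h)].

Lemma lattice_box_open z e : open (lattice_box z e).
Proof.
rewrite openE => y [h [hR hI] l].
pose e1 := Num.min (e - `|Re h|) (e - `|Im h|).
apply/nbhs_boxP; exists e1; first by rewrite lt_min !subr_gt0 hR.
move=> y'; rewrite !lt_min => /andP[y1 _] /andP[_ y2].
exists (h + (y' - y)); last by rewrite (_ : _ - _ = y - z - h)//; ring.
rewrite !cplxE; split; apply: le_lt_trans (ler_normD _ _) _; lra.
Qed.

Lemma lattice_box_lattice z e y y' : lattice (y - y') ->
  lattice_box z e y -> lattice_box z e y'.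
Proof.
move=> l [h hh l']; exists h => //.
rewrite (_ : _ - h = (y - z - h) - (y - y')); last by ring.
by rewrite latticeD// latticeN.
Qed.

Lemma lattice_box_refl z e : 0 < e -> lattice_box z e z.
Proof. by exists 0; rewrite /= ?normr0// subrr subr0 lattice0. Qed.

Lemma cover_hausdorff : hausdorff_space cover.
Proof.
rewrite open_hausdorff => p q pq.
have [z [s [pE _ _]]] := pt_surj p; have [w [t [qE _ _]]] := pt_surj q.
have [zw|zw] := boolP (lattice (z - w)); last first.
  have /near_boxP[e e0 eP] := lattice_closed zw.
  pose O x := lattice_box x (e / 2).
  have Oxx x : O x x by apply: lattice_box_refl; rewrite divr_gt0.
  exists ([set pt x s | x in O z & s in [set: bool]],
          [set pt x s | x in O w & s in [set: bool]]); split=> /=.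
  - by apply: mem_set; rewrite pE; exists z => //; exists s.
  - by apply: mem_set; rewrite qE; exists w => //; exists t.
  - by apply: pt_open; [exact: lattice_box_open|exact: lattice_box_lattice].
  - by apply: pt_open; [exact: lattice_box_open|exact: lattice_box_lattice].
  apply/eqP/seteqP; split=> // _ [[x [h [hR hI] l] [t1 _ <-]]].
  move=> [x' [h' [hR' hI'] l'] [t2 _ /pt_eqP[xx' _]]].
  have := eP (h - h'); rewrite add0r !cplxE.
  have lt2 (a a' : R) : `|a| < e / 2 -> `|a'| < e / 2 -> `|a - a'| < e.
    by move=> aa aa'; apply: le_lt_trans (ler_normB _ _) _; lra.
  move=> /(_ (lt2 _ _ hR hR') (lt2 _ _ hI hI')) /negP; apply.
  rewrite (_ : _ + _ = (x' - w - h') + (x - x') - (x - z - h)); last by ring.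
  by apply: latticeD; [apply: latticeD => //; rewrite latticeC|rewrite latticeN].
have [bz|bz] := boolP (branch z).
  by case/eqP : pq; rewrite pE qE; apply/pt_eqP; split=> //; left.
(* The two points now lie over one regular point of the torus; the two charts of a rectangle around
   it have disjoint images. *)
have [n [x [_ nx zx]]] := rect_cover beta01 bz.
have px : p = pt x s by rewrite pE; apply/pt_eqP; split=> //; right.
have qx : q = pt x t.
  rewrite qE; apply/pt_eqP; split; last by right.
  rewrite (_ : w - x = (z - x) - (z - w)); last by ring.
  by rewrite latticeD// latticeN.
have st : t = ~~ s.
  by move: pq; rewrite px qx; case: (s) (t) => -[] //; rewrite eqxx.
pose C s' := [set pt (coord None u) (rect_sheet n s' u) | u in rect n].
have oC s' : open (C s').
  apply: (good_image_open beta01 (good_rect alpha beta01 n s')) => //.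
  exact: rect_open.
pose c := (n == 2)%N && (Im x < 0).
exists (C (s (+) c), C (~~ s (+) c)); split=> //=.
- apply: mem_set; rewrite px; exists x => //; rewrite /rect_sheet /c.
  by case: (s) (_ && _) => -[].
- apply: mem_set; rewrite qx; exists x => //; rewrite /rect_sheet /c st.
  by case: (s) (_ && _) => -[].
apply/eqP/seteqP; split=> // _ [[y ny <-] [y' ny' /pt_eqP[yy' by']]].
have E := rect_inj beta01 ny' ny yy'; move: by'; rewrite E.
have [+ _] := rect_slit alpha beta01 ny => /negbTE -> [//|].
by rewrite /rect_sheet addNb; case: (s) (c) (_ && _) => -[] [].
Qed.

(* Along the slit, pt is discontinuous on each sheet; it is continuous as a map
   to unordered pairs of points. *)
Lemma pt_near z (V : set cover) : open V -> (forall s, V (pt z s)) ->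
  \forall w \near z, forall s, V (pt w s).
Proof.
move=> [V1 V2] Vz.
have [bz|bz] := boolP (branch z); last first.
  apply/near0P; apply: filterS2 (V1 z true bz (Vz true)) (V1 z false bz (Vz false)) => h /=.
  by case: (slit z && _) => Vt Vf [].
have /(branchP alpha beta01)[b l] := bz.
have zb h s : pt (z + h) s = pt (branch_pt b + h) s.
  by apply/pt_eqP; split; [rewrite opprD addrACA subrr addr0|right].
have Vb s : V (pt (branch_pt b) s) by have := zb 0 s; rewrite !addr0 => <-.
have N0 := V2 b true (Vb true).
have /near_boxP[e e0 eP] := N0.
have N1 : \forall u \near (0 : cplx R), V (pt (branch_pt b + u ^+ 2) (sheet b u)) /\
    V (pt (branch_pt b + u ^+ 2) (sheet b (- u))).
  apply/near_boxP; exists e => // h hR hI; split; first exact: eP.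
  by have := eP (- h); rewrite !add0r sqrrN !cplxE !normrN; apply.
apply/near0P; have := coord_open beta (Some b) N1.
apply: filterS => h [v [Vv Vv'] vE] s; rewrite zb.
move: vE; rewrite /= expr0n addr0 => <-.
have [v0|v0] := eqVneq v 0; first by rewrite v0 expr0n addr0.
by move: Vv Vv'; rewrite sheetN//; case: (sheet b v) s => -[].
Qed.

End topology.

(** * Compactness and connectedness *)

Section compact_connected.
Context {R : realType}.
Variables alpha beta : R.
Hypothesis beta01 : 0 < beta < 1.
Implicit Types (z w u v h : cplx R) (b s : bool).

Local Notation xi := (xi alpha).
Local Notation slit := (slit alpha beta).
Local Notation branch := (branch alpha beta).
Local Notation branch_pt := (branch_pt beta).
Local Notation cover := (cover alpha beta).
Local Notation pt := (pt alpha beta).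

(** The surface is the image of two copies of the unit square, but [pt] is not continuous on a
    single sheet. The covering property is therefore applied on the square to a predicate about both
    sheets at once, for which [pt_near] replaces continuity. *)
Lemma cover_compact : compact [set: cover].
Proof.
apply/compact_near_coveringP => I F P FF HP.
have K : compact ([set` `[0, 1]] `*` [set` `[0, 1]] : set (R * R)).
  by apply: compact_setX; exact: segment_compact.
pose g (a : R * R) : cplx R := (a.1 - a.2 * alpha) +i* a.2.
have gc : continuous g.
  move=> a A /nbhs_boxP[e e0 eA].
  have c1 : {for a, continuous (fun a : R * R => a.1 - a.2 * alpha)}.
    apply: (@continuousB _ _ _ (fun a : R * R => a.1) (fun a => a.2 * alpha)).
      exact: cvg_fst.
    apply: (@continuousM _ _ (fun a : R * R => a.2) (fun=> alpha)).
      exact: cvg_snd.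
    exact: cst_continuous.
  have c2 : {for a, continuous (fun a : R * R => a.2)} by exact: cvg_snd.
  have H1 : \forall b \near a, `|(b.1 - b.2 * alpha) - (a.1 - a.2 * alpha)| < e.
    by move/cvgrPdist_lt : c1 => /(_ e e0); apply: filterS => b; rewrite distrC.
  have H2 : \forall b \near a, `|b.2 - a.2| < e.
    by move/cvgrPdist_lt : c2 => /(_ e e0); apply: filterS => b; rewrite distrC.
  have : \forall b \near a, A (g b) by apply: filterS2 H1 H2 => b b1 b2; exact: eA.
  by [].
have /compact_near_coveringP/(_ I F (fun i a => forall s, P i (pt (g a) s)) FF) := K.
move=> H; have {}H := H _.
have : \near F, ([set` `[0, 1]] `*` [set` `[0, 1]]) `<=`
    (fun a : R * R => forall s, P F (pt (g a) s)).
  apply: H => a _.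
  have [[U0 B0] [/= U0n B0n] UB0] := HP (pt (g a) false) Logic.I.
  have [[U1 B1] [/= U1n B1n] UB1] := HP (pt (g a) true) Logic.I.
  have oV : open (U0^° `|` U1^°) by apply: openU; exact: open_interior.
  have Va s : (U0^° `|` U1^°) (pt (g a) s) by case: s; [right|left].
  have /gc H1 := pt_near beta01 oV Va.
  exists ([set b | forall s, (U0^° `|` U1^°) (pt (g b) s)], B0 `&` B1).
    by split=> //=; exact: filterI.
  move=> [b i] [/= bP [i0 i1]] s; have [/interior_subset bs|/interior_subset bs] := bP s.
    exact: (UB0 (pt (g b) s, i)).
  exact: (UB1 (pt (g b) s, i)).
apply: filterS => i iP q _.
have [z [s [-> xiz Imz]]] := pt_surj q.
have -> : z = g (xi z, Im z).
  by apply: (xi_inj (alpha := alpha)) => //; rewrite [RHS]xiE /= subrK.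
by apply: iP; split; rewrite /= in_itv /=; move: xiz Imz => /andP[? ?] /andP[? ?]; alra.
Qed.

(** On each sheet the strip 0 < Im z < 1 avoids slit and branch points, and it is swept out by
    horizontal and vertical moves. Every branch point is in the closure of both strips, and every
    other point is in the closure of one. *)
Lemma cover_connected : connected [set: cover].
Proof.
move=> B [q0 Bq0] [C1 oC1 BE1] [C2 cC2 BE2].
have oB : open B by rewrite BE1 setTI.
have oBc : open (~` B) by rewrite BE2 setTI; exact: closed_openC.
have [B1 _] := oB; have [Bc1 _] := oBc.
have germ z s : ~~ branch z -> ~~ slit z ->
    \forall w \near z, B (pt w s) <-> B (pt z s).
  move=> bz sz; apply/near0P.
  have [Bz|Bz] := pselect (B (pt z s)).
    have := B1 z s bz Bz; rewrite (negbTE sz) /= addbF.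
    by apply: filterS.
  have := Bc1 z s bz Bz; rewrite (negbTE sz) /= addbF.
  by apply: filterS => h nB; split.
have strip z w s : 0 < Im z < 1 -> 0 < Im w < 1 -> B (pt z s) -> B (pt w s).
  have reg x y : 0 < y < 1 -> ~~ branch (x +i* y) /\ ~~ slit (x +i* y).
    by move=> /not_int01 y01; rewrite branchE slitE /= y01.
  case: z w => [x y] [x' y'] /= y01 y'01 Bz.
  have Bx : B (pt (x' +i* y) s).
    pose M := `|x| + `|x'| + 1.
    apply: (@locally_constant_itv _ (fun x => B (pt (x +i* y) s)) (- M) M _ x x') => //.
    - move=> t _; have [bt st] := reg t y y01.
      have [e e0 eP] := near_addr (germ _ s bt st).
      apply/nbhs_ballP; exists e => // t'; rewrite /ball /= distrC => /eP[+ _].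
      by rewrite (_ : _ + _ = t' +i* y)//; apply/cplx_eqP; split=> /=; lra.
    - by rewrite -ltr_norml /M; have := normr_ge0 x'; lra.
    - by rewrite -ltr_norml /M; have := normr_ge0 x; lra.
  apply: (@locally_constant_itv _ (fun y => B (pt (x' +i* y) s)) 0 1 _ y y') => //.
  move=> t t01; have [bt st] := reg x' t t01.
  have [e e0 eP] := near_addr (germ _ s bt st).
  apply/nbhs_ballP; exists e => // t'; rewrite /ball /= distrC => /eP[_ +].
  by rewrite (_ : _ + _ = x' +i* t')//; apply/cplx_eqP; split=> /=; lra.
(* The coordinates d + id and -(d + id) have the same square 2 d^2 i, which lies in the strip, and
   opposite sheets. *)
have at_branch b z s : 0 < Im z < 1 -> B (pt (branch_pt b) false) <-> B (pt z s).
  move=> z01.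
  have sw V : open V -> V (pt (branch_pt b) false) ->
      exists2 w, 0 < Im w < 1 & V (pt w s).
    move=> [_ V2] /V2/near_boxP[e e0 eP].
    pose d := Num.min e 1 / 2.
    have d0 : 0 < d by rewrite divr_gt0// lt_min e0 ltr01.
    have de : d < e by rewrite ltr_pdivrMr// gt_min; apply/orP; left; lra.
    have d1 : d <= 2^-1 by rewrite ler_pdivrMr// mulVf// ge_min lexx orbT.
    have imd : 0 < Im (branch_pt b + (d +i* d) ^+ 2) < 1.
      by rewrite ImD Im_sqr /= add0r; apply/andP; split; nra.
    have [sd|sd] := eqVneq (sheet b (d +i* d)) s.
      exists (branch_pt b + (d +i* d) ^+ 2) => //; rewrite -sd -[d +i* d]add0r.
      by apply: eP; rewrite /= gtr0_norm.
    exists (branch_pt b + (d +i* d) ^+ 2) => //.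
    have -> : s = sheet b (- (d +i* d)).
      rewrite sheetN; first by move: sd; case: (sheet _ _) s => -[].
      by rewrite eq_complex /= (gt_eqF d0).
    rewrite -sqrrN -[- (d +i* d)]add0r.
    by apply: eP; rewrite /= normrN gtr0_norm.
  have [Bb|Bb] := pselect (B (pt (branch_pt b) false)).
    by have [w w01 Bw] := sw _ oB Bb; split=> // _; exact: strip Bw.
  have [w w01 Bw] := sw _ oBc Bb; split=> // Bz; exfalso; apply: Bw.
  exact: strip Bz.
have half01 : 0 < Im (0 +i* 2^-1 : cplx R) < 1 by rewrite /=; alra.
have all_eq q : B q <-> B (pt (branch_pt false) false).
  have [z [s [-> xiz Imz]]] := pt_surj q.
  have [bz|bz] := boolP (branch z).
    have /(branchP alpha beta01)[b l] := bz.
    have -> : pt z s = pt (branch_pt b) false by apply/pt_eqP; split=> //; left.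
    by rewrite (at_branch b _ true half01) (at_branch false _ true half01).
  (* An upward move never changes the sheet, even from a point of the slit. *)
  have up V : open V -> V (pt z s) -> exists2 w, 0 < Im w < 1 & V (pt w s).
    move=> [V1 _] /(V1 _ _ bz)/near_boxP[e e0 eP].
    pose d := Num.min e (1 - Im z) / 2.
    move: Imz => /andP[z0 z1].
    have m0 : 0 < Num.min e (1 - Im z) by rewrite lt_min e0 subr_gt0.
    have d0 : 0 < d by rewrite divr_gt0.
    have dm : d < Num.min e (1 - Im z) by rewrite /d; lra.
    move: dm; rewrite lt_min => /andP[de dz].
    exists (z + d *i); first by rewrite ImD /=; apply/andP; split; lra.
    have := eP (d *i); rewrite add0r /= normr0 (gtr0_norm d0) (lt_gtF d0) andbF addbF.
    exact.
  have [Bz|Bz] := pselect (B (pt z s)).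
    have [w w01 Bw] := up _ oB Bz; split=> // _.
    exact/(at_branch false _ s w01).
  have [w w01 Bw] := up _ oBc Bz; split=> // Bb; exfalso; apply: Bw.
  exact/(at_branch false _ s w01).
apply/seteqP; split=> // q _; apply/all_eq.
exact/(all_eq q0).
Qed.

End compact_connected.

(** * The translation surface *)

Section surface.
Context {R : realType}.
Variables alpha beta : R.
Hypothesis beta01 : 0 < beta < 1.
Implicit Types (z w u v h : cplx R) (b s : bool) (k : option bool)
  (D : set (cplx R)) (sg : cplx R -> bool).

Local Notation branch := (branch alpha beta).
Local Notation cover := (cover alpha beta).
Local Notation pt := (pt alpha beta).
Local Notation near_branch := (near_branch beta).
Local Notation coord := (coord beta).
Local Notation slope := (@slope R).
Local Notation good_chart := (good_chart alpha beta).
Local Notation cover_chart := (@cover_chart R alpha beta).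
Local Notation sing := (@sing R alpha beta).

Lemma near_branch0 : near_branch 0.
Proof.
case/andP : beta01 => ? ?.
by split; rewrite /= normr0 lt_min subr_gt0; apply/andP.
Qed.

Lemma good_branch_chart b :
  good_chart (Some b) [set u | near_branch (u ^+ 2)] (sheet b).
Proof.
split=> //=.
- rewrite openE => u [uR uI].
  pose rho := Num.min beta (1 - beta).
  have H : \forall h \near (0 : cplx R), near_branch (u ^+ 2 + h).
    apply/near_boxP; exists (Num.min (rho - `|Re (u ^+ 2)|) (rho - `|Im (u ^+ 2)|)).
      by rewrite lt_min !subr_gt0 uR uI.
    move=> h; rewrite add0r !lt_min => /andP[hR _] /andP[_ hI].
    by split; rewrite !cplxE; apply: le_lt_trans (ler_normD _ _) _;
      rewrite addrC -ltrBrDr.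
  have := coord_near beta (Some b) u H; apply: filterS => v.
  by rewrite /= opprD addrACA subrr add0r addrCA subrr addr0.
- move=> u v uD vD /pt_eqP[l uv].
  have E : u ^+ 2 = v ^+ 2.
    apply/eqP; rewrite -subr_eq0; apply/eqP.
    move: l; rewrite opprD addrACA subrr add0r => l.
    move: uD vD; rewrite !near_branchE !lt_min !ltr_norml => -[].
    move=> /andP[/andP[? ?] /andP[? ?]] /andP[/andP[? ?] /andP[? ?]] [].
    move=> /andP[/andP[? ?] /andP[? ?]] /andP[/andP[? ?] /andP[? ?]].
    by apply: (lattice_small_Re l); rewrite !cplxE ltr_norml; alra.
  have [u0|u0] := eqVneq u 0.
    by move/eqP : E; rewrite u0 expr0n eq_sym expf_eq0 /= => /eqP ->.
  move/eqP : E; rewrite eqf_sqr => /orP[/eqP //|/eqP uv'].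
  have v0 : v != 0 by move: u0; rewrite uv' oppr_eq0.
  case: uv => [/(branch_near_branch beta01 uD)/eqP|].
    by rewrite expf_eq0 (negbTE u0).
  by rewrite uv' sheetN//; case: (sheet b v).
- move=> u uD bu.
  have u0 : u != 0.
    by apply: contraNneq bu => ->; rewrite expr0n addr0 branch_pt_branch.
  apply: filterS (sheet_near alpha beta01 b u0 uD) => v ->.
  by rewrite opprD addrACA subrr add0r.
Qed.

Definition cover_atlas : set (local_param R cover) :=
  [set c | exists k D sg, good_chart k D sg /\ c = cover_chart k D sg].

(* The form is dz, which is 2 u du in a branch chart z = branch_pt b + u ^ 2;
   only the branch charts contain a singularity. *)
Definition cover_coef (c : local_param R cover) (p : cover) : cplx R :=
  if pselect (exists2 q, dom c q & sing q) then 2 * c p else 1.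

Lemma cover_coefE k D sg u : good_chart k D sg -> D u ->
  cover_coef (cover_chart k D sg) (pt (coord k u) (sg u)) = slope k u u.
Proof.
move=> gD Du; rewrite /cover_coef (chartK gD)//.
case: pselect => /= [ex|nb].
  case: k gD ex => [b|] gD ex /=; first by rewrite mulr2n mulrDl mul1r.
  case: ex => _ [v Dv <-] /sing_pt bv.
  by have := good_branch gD v Dv; rewrite bv.
case: k gD nb => [b|] // gD []; exists (pt (coord (Some b) 0) (sg 0)).
  by exists 0 => //; have [-> _] := good_branch gD; rewrite /= expr0n; exact: near_branch0.
by apply/sing_pt; rewrite /= expr0n addr0 branch_pt_branch.
Qed.

Lemma rect_chart n s : cover_atlas (cover_chart None (rect beta n) (rect_sheet n s)).
Proof. by exists None, (rect beta n), (rect_sheet n s); split=> //; exact: good_rect. Qed.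

Lemma regular_cover z s : ~~ branch z -> exists n w t,
  [/\ (n < 4)%N, rect beta n w & pt z s = pt w (rect_sheet n t w)].
Proof.
move=> bz; have [n [w [n4 nw zw]]] := rect_cover beta01 bz.
exists n, w, (s (+) ((n == 2)%N && (Im w < 0))); split=> //.
by apply/pt_eqP; split=> //; right; rewrite /rect_sheet -addbA addbb addbF.
Qed.

Lemma cover_atlas_cover p : exists2 c, cover_atlas c & dom c p.
Proof.
have [z [s [-> _ _]]] := pt_surj p.
have [bz|bz] := boolP (branch z).
  have /(branchP alpha beta01)[b l] := bz.
  exists (cover_chart (Some b) [set u | near_branch (u ^+ 2)] (sheet b)).
    exists (Some b), [set u | near_branch (u ^+ 2)], (sheet b); split=> //.
    exact: good_branch_chart.
  exists 0; first by rewrite /= expr0n; exact: near_branch0.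
  apply/pt_eqP; rewrite /= expr0n addr0 latticeC; split=> //; left.
  exact: branch_pt_branch.
have [n [w [t [_ nw ->]]]] := regular_cover s bz.
by exists (cover_chart None (rect beta n) (rect_sheet n t)); [exact: rect_chart|exists w].
Qed.

Lemma cover_atlas_chart c : cover_atlas c -> is_chart c.
Proof. by move=> [k [D [sg [gD ->]]]]; exact: good_is_chart. Qed.

Lemma cover_transition c e : cover_atlas c -> cover_atlas e ->
  forall p, dom c p -> dom e p ->
  exists2 a, has_coord_derivative c p e a & cover_coef c p = cover_coef e p * a.
Proof.
move=> [k [D [sg [gD ->]]]] [k' [D' [sg' [gD' ->]]]] _ [u Du <-] [u' Du' uu'].
have [a ca ea] := good_transition beta01 gD gD' Du Du' (esym uu').
by exists a => //; rewrite cover_coefE// -uu' cover_coefE.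
Qed.

Lemma cover_atlas_holomorphic c e : cover_atlas c -> cover_atlas e ->
  forall p, dom c p -> dom e p -> exists a, has_coord_derivative c p e a.
Proof.
by move=> ca ea p cp ep; have [a ? _] := cover_transition ca ea cp ep; exists a.
Qed.

Definition cover_rs : closed_riemann_surface R :=
  ClosedRiemannSurface (cover_hausdorff beta01) (cover_compact beta01)
    (cover_connected beta01) cover_atlas_cover cover_atlas_chart
    cover_atlas_holomorphic.

Lemma cover_coef_holomorphic c : cover_atlas c ->
  forall p, dom c p -> exists a, has_coord_derivative c p (cover_coef c) a.
Proof.
move=> [k [D [sg [gD ->]]]] _ [u Du <-].
rewrite /has_coord_derivative (chartK gD Du).
set f := (_ \o _).
have fE : \forall v \near u, f v = slope k v v.
  apply: filterS (open_nbhs_nbhs (conj (good_open gD) Du)) => v Dv.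
  by rewrite /f /= (chart_inv beta01 gD)// cover_coefE.
have fu : f u = slope k u u := nbhs_singleton fE.
exists (if k is Some _ then 2 else 0).
apply: (@derive_caratheodory _ f (fun=> if k is Some _ then 2 else 0)).
  exact: cst_continuous.
apply: filterS fE => v ->; rewrite fu.
by case: (k) => [b|] /=; [ring|rewrite subrr mulr0].
Qed.

Lemma cover_coef_change c e : cover_atlas c -> cover_atlas e ->
  forall p, dom c p -> dom e p ->
  forall a, has_coord_derivative c p e a -> cover_coef c p = cover_coef e p * a.
Proof.
move=> ca ea p cp ep a da; have [a' da' ->] := cover_transition ca ea cp ep.
by rewrite (coord_derivative_uniq da da').
Qed.

Lemma rect0_half : rect beta 0 (2^-1 +i* 2^-1 : cplx R).
Proof. by split; rewrite /= /rect_lo /rect_hi /rect_bot /=; alra. Qed.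

Lemma cover_form_nonzero :
  exists c p, [/\ cover_atlas c, dom c p & cover_coef c p != 0].
Proof.
exists (cover_chart None (rect beta 0) (rect_sheet 0 false)).
pose w : cplx R := 2^-1 +i* 2^-1.
exists (pt w (rect_sheet 0 false w)); split.
- exact: rect_chart.
- by exists w => //; exact: rect0_half.
- rewrite (cover_coefE (good_rect alpha beta01 0 false) rect0_half).
  exact: oner_neq0.
Qed.

Definition slit_cover : translation_surface R :=
  @TranslationSurface R cover_rs cover_coef cover_coef_holomorphic
    cover_coef_change cover_form_nonzero.

Lemma zeros_slit_cover : zeros slit_cover = sing.
Proof.
apply/seteqP; split=> p /=.
  have [z [s [-> _ _]]] := pt_surj p.
  have [bz _|bz] := boolP (branch z); first by apply/sing_pt.
  have [n [w [t [_ nw ->]]]] := regular_cover s bz.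
  move=> /(_ (cover_chart None (rect beta n) (rect_sheet n t)) (rect_chart n t)).
  have H : dom (cover_chart None (rect beta n) (rect_sheet n t))
      (pt w (rect_sheet n t w)) by exists w.
  move=> /(_ H); rewrite [coef _ _](cover_coefE (good_rect alpha beta01 n t) nw).
  by move/eqP; rewrite oner_eq0.
move=> bp c [k [D [sg [gD ->]]]] [u Du uE]; rewrite -uE.
apply: etrans (cover_coefE gD Du) _.
move: bp; rewrite -uE => /sing_pt/(good_branchP beta01 gD Du)[].
by case: k gD uE => // b _ _ _ ->; rewrite /= addr0.
Qed.

Lemma natural_good D sg : good_chart None D sg ->
  @natural_param R slit_cover (cover_chart None D sg).
Proof.
move=> gD; split.
- exact: good_is_chart.
- rewrite zeros_slit_cover => _ [u Du <-] /sing_pt bu.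
  by have := good_branch gD u Du; rewrite bu.
- move=> c ca p cp dp.
  have da : cover_atlas (cover_chart None D sg) by exists None, D, sg.
  have [a ha aE] := cover_transition ca da cp dp.
  suff -> : @coef R slit_cover c p = a by [].
  rewrite [LHS]aE; case: dp => u Du uE.
  have -> : cover_coef (cover_chart None D sg) p = 1.
    by rewrite -uE; exact: (cover_coefE gD Du).
  by rewrite mul1r.
Qed.

End surface.

(** * Saddle connections *)

Lemma within_continuous_near (R : realType) (T : topologicalType) (f : R -> T)
    (A : set R) a V :
  {within A, continuous f} -> A a -> nbhs (f a) V ->
  exists2 e : R, 0 < e & forall u, `|u - a| < e -> A u -> V (f u).
Proof.
move=> fc Aa Va.
have : nbhs_subspace (a : subspace A) (f @^-1` V) := fc a V Va.
rewrite -nbhs_subspace_in// => /nbhs_ballP[e /= e0 eP].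
by exists e => // u ue Au; apply: eP => //; rewrite /ball /= distrC.
Qed.

Section teich_map.
Context {R : realType}.
Implicit Types (z w : cplx R) (t x : R).

Lemma teich_mapK t : cancel (teich_map t) (teich_map (- t)).
Proof.
move=> [x y]; rewrite /teich_map /= !mulNr !opprK !mulrA -!expRD addNr subrr expR0 !mul1r.
by [].
Qed.

Lemma teich_mapVK t : cancel (teich_map (- t)) (teich_map t).
Proof. by move=> z; have := teich_mapK (- t) z; rewrite opprK. Qed.

Lemma teich_mapD t z w : teich_map t (z + w) = teich_map t z + teich_map t w.
Proof. by apply/cplx_eqP; rewrite !cplxE /= !cplxE !mulrDr. Qed.

Lemma teich_mapZ t x z : teich_map t (x%:C * z) = x%:C * teich_map t z.
Proof. by case: z => a b; apply/cplx_eqP; split=> /=; ring. Qed.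

End teich_map.

Section straight_lines.
Context {R : realType}.
Variables alpha beta : R.
Hypothesis beta01 : 0 < beta < 1.
Implicit Types (z w u h : cplx R) (b s : bool).

Local Notation lattice := (lattice alpha).
Local Notation branch := (branch alpha beta).
Local Notation branch_pt := (branch_pt beta).
Local Notation cover := (cover alpha beta).
Local Notation pt := (pt alpha beta).
Local Notation rect := (rect beta).
Local Notation sing := (@sing R alpha beta).
Local Notation S := (slit_cover alpha beta01).

(** Straightness is tested in the deformed rectangle charts; undoing the deformation turns the
    velocity [v] into [teich_map (- t) v]. *)
Lemma straight_local t v (a b : R) (gamma : R -> S) (s : R) :
  straight (teich t (flat S)) v a b gamma -> a < s < b ->
  exists n z c, rect n z /\
    \forall u \near s, let z' := z + (u - s)%:C * teich_map (- t) v in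
      rect n z' /\ gamma u = pt z' (rect_sheet n c z').
Proof.
move=> st sab; have [/= nsing loc] := st s sab.
rewrite zeros_slit_cover in nsing.
have [z0 [s0 [gE _ _]]] := pt_surj (gamma s : cover).
have bz0 : ~~ branch z0 by apply/negP => b0; apply: nsing; rewrite gE; apply/sing_pt.
have [n [z [c [_ nz zE]]]] := regular_cover beta01 s0 bz0.
have gD := good_rect alpha beta01 n c.
pose phi : local_param R S := cover_chart alpha beta None (rect n) (rect_sheet n c).
exists n, z, c; split=> //.
have nat : natural (teich t (flat S)) (LocalParam (dom phi) (teich_map t \o phi)).
  by exists phi => //; exact: natural_good.
have gz : gamma s = pt z (rect_sheet n c z) by rewrite gE.
have dphi : dom phi (gamma s) by rewrite gz; exists z.
have phis : phi (gamma s) = z by rewrite gz; exact: (chartK gD).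
apply: filterS (loc _ nat dphi) => u /= [[y ny yE]].
have -> : xget 0 [set u0 | rect n u0 /\ pt u0 (rect_sheet n c u0) = gamma u] =
  phi (gamma u) by [].
have -> : xget 0 [set u0 | rect n u0 /\ pt u0 (rect_sheet n c u0) = gamma s] =
  phi (gamma s) by [].
have phiu : phi (gamma u) = y by rewrite -yE; exact: (chartK gD).
rewrite phis phiu => /(congr1 (teich_map (- t))).
by rewrite teich_mapK teich_mapD teich_mapK teich_mapZ => <-.
Qed.

(** Lying over a given line of the plane, up to the lattice, is a locally constant property along
    the interior of [gamma]. By continuity the ends of that line are congruent to branch points. *)
Lemma saddle_holonomy t v (gamma : R -> S) :
  saddle_connection (teich t (flat S)) v gamma ->
  exists b b', lattice (teich_map (- t) v - (branch_pt b' - branch_pt b)).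
Proof.
move=> [_ gc st]; set w := teich_map (- t) v.
rewrite /= zeros_slit_cover => s0 s1.
have h01 : 0 < (2^-1 : R) < 1 by alra.
have [z0 [c0 [g0 _ _]]] := pt_surj (gamma 2^-1 : cover).
pose L (u : R) := exists c, gamma u = pt (z0 + (u - 2^-1)%:C * w) c.
have line (u : R) : 0 < u < 1 -> L u.
  move=> u01; suff H : forall x : R, 0 < x < 1 -> \forall y \near x, L y <-> L x.
    apply: (@locally_constant_itv R L 0 1 H 2^-1 u) => //.
    by exists c0; rewrite subrr mul0r addr0.
  move=> x x01; have [n [z [c [nz loc]]]] := straight_local st x01.
  have gx : gamma x = pt z (rect_sheet n c z).
    by have [_] := nbhs_singleton loc; rewrite subrr mul0r addr0.
  apply: filterS loc => y [ny gy].
  have E : lattice (z + (y - x)%:C * w - (z0 + (y - 2^-1)%:C * w)) =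
      lattice (z - (z0 + (x - 2^-1)%:C * w)).
    by congr (lattice _); rewrite !rmorphB; ring.
  split=> [[d yE]|[d xE]].
    move: gy; rewrite yE => /esym/pt_eqP[l _].
    by exists (rect_sheet n c z); rewrite gx; apply/pt_eqP; split; [rewrite -E|right].
  move: gx; rewrite xE => /esym/pt_eqP[l _].
  exists (rect_sheet n c (z + (y - x)%:C * w)).
  by rewrite gy; apply/pt_eqP; split; [rewrite E|right].
have endpt (a : R) : 0 <= a <= 1 -> sing (gamma a) ->
    exists b, lattice (z0 + (a - 2^-1)%:C * w - branch_pt b).
  move=> a01 [x [c [gaE /(branchP alpha beta01)[b l]]]]; exists b.
  apply: contrapT => /negP/lattice_closed/near_boxP[e e0 eP].
  have ga : gamma a = pt (branch_pt b) c.
    by rewrite gaE; apply/pt_eqP; split=> //; right.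
  pose V := [set pt y s | y in lattice_box alpha (branch_pt b) (e / 2) & s in [set: bool]].
  have Va : nbhs (gamma a : cover) V.
    apply: open_nbhs_nbhs; split.
      by apply: pt_open => //; [exact: lattice_box_open|exact: lattice_box_lattice].
    rewrite ga; exists (branch_pt b); last by exists c.
    by apply: lattice_box_refl; rewrite divr_gt0.
  have a01' : `[0, 1]%classic a by rewrite /= in_itv.
  have [d d0 dV] := within_continuous_near gc a01' Va.
  pose M := `|Re w| + `|Im w| + 1.
  have M0 : 0 < M by rewrite /M; have := normr_ge0 (Re w); have := normr_ge0 (Im w); lra.
  (* An interior parameter close to [a]: a step to the right if a < 1/2 and to the left
     otherwise. *)
  have [u [u01 ud uM]] : exists u : R, [/\ 0 < u < 1, `|u - a| < d & `|u - a| * M < e / 2].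
    pose r := Num.min (Num.min d (e / 2 / M)) 1 / 3.
    have r0 : 0 < r by rewrite divr_gt0// !lt_min d0 ltr01 !divr_gt0.
    have : r < Num.min (Num.min d (e / 2 / M)) 1 by rewrite /r in r0 *; lra.
    rewrite !lt_min => /andP[/andP[rd rM] r1].
    have rhalf : r <= 3^-1.
      have m1 : Num.min (Num.min d (e / 2 / M)) 1 <= 1 by rewrite ge_min lexx orbT.
      by rewrite /r; lra.
    have r2 : r * M < e / 2 by rewrite -ltr_pdivlMr.
    move: a01 => /andP[a0 a1].
    have [ah|ah] := ltP a 2^-1.
      exists (a + r); rewrite addrAC subrr add0r gtr0_norm//; split=> //.
      by alra.
    exists (a - r); rewrite addrAC subrr add0r normrN gtr0_norm//; split=> //.
    by alra.
  have u01' : `[0, 1]%classic u by move: u01 => /andP[? ?]; rewrite /= in_itv /=; alra.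
  have [c' gu] := line u u01.
  have := dV u ud u01'; rewrite gu => -[y [h [hR hI] yl] [c'' _ /pt_eqP[yu _]]].
  have := eP ((u - a)%:C * w - h).
  have lt2 (p p' : R) : `|p| < e / 2 -> `|p'| < e / 2 -> `|p - p'| < e.
    by move=> pp pp'; apply: le_lt_trans (ler_normB _ _) _; lra.
  have wR : `|Re ((u - a)%:C * w)| < e / 2.
    rewrite (_ : Re _ = (u - a) * Re w); last by case: (w) => ? ? /=; ring.
    rewrite normrM; apply: le_lt_trans uM; rewrite ler_wpM2l// /M.
    by have := normr_ge0 (Im w); lra.
  have wI : `|Im ((u - a)%:C * w)| < e / 2.
    rewrite (_ : Im _ = (u - a) * Im w); last by case: (w) => ? ? /=; ring.
    rewrite normrM; apply: le_lt_trans uM; rewrite ler_wpM2l// /M.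
    by have := normr_ge0 (Re w); lra.
  rewrite !cplxE => /(_ (lt2 _ _ wR hR) (lt2 _ _ wI hI))/negP; apply.
  rewrite (_ : _ + _ = (y - branch_pt b - h) - (y - (z0 + (u - 2^-1)%:C * w))).
    by rewrite latticeD// latticeN.
  by rewrite !rmorphB; ring.
have [b lb] := endpt 0 ltac:(alra) s0.
have [b' lb'] := endpt 1 ltac:(alra) s1.
exists b, b'.
rewrite (_ : _ - _ = (z0 + (1 - 2^-1)%:C * w - branch_pt b') -
    (z0 + (0 - 2^-1)%:C * w - branch_pt b)).
  by rewrite latticeD// latticeN.
by rewrite !rmorphB; ring.
Qed.

End straight_lines.

(** * Lower bound for saddle connections at the chosen times *)

Section depth.
Context {R : realType}.
Variables alpha beta : R.
Hypothesis beta01 : 0 < beta < 1.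

Local Notation lattice := (lattice alpha).
Local Notation S := (slit_cover alpha beta01).

Variables (p : int) (q : nat) (eps : R).
Hypothesis q_gt0 : (0 < q)%N.
Hypothesis pq_coprime : coprimez p q.
Hypothesis eta_ge0 : 0 <= q%:R * alpha - p%:~R.
Hypothesis eta_le : q%:R * (q%:R * alpha - p%:~R) <= 1.
Hypothesis eps01 : 0 < eps <= 1.
Hypothesis beta_far : forall n : int, eps <= `|q%:R * beta - n%:~R|.

Let t : R := 2 * ln q%:R.

Lemma normc_ge_ReIm (z : cplx R) :
  `|Re z| <= ComplexField.Normc.normc z /\ `|Im z| <= ComplexField.Normc.normc z.
Proof.
by case: z => a b /=; rewrite -!sqrtr_sqr; split; rewrite ler_wsqrtr//
  ?lerDl ?lerDr sqr_ge0.
Qed.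

(* The determinant of the holonomy with the lattice vector approximating the
   vertical direction is computed before the deformation, which preserves it,
   and bounded after the deformation, when that vector has bounded length. *)
Lemma saddle_length_ge v (gamma : R -> S) :
  saddle_connection (teich t (flat S)) v gamma ->
  eps / 2 <= ComplexField.Normc.normc v.
Proof.
move=> sc; have [v0 _ _ _ _] := sc.
have [b [b' /andP[/intrP[M xiM] /intrP[N imN]]]] := saddle_holonomy sc.
set w := teich_map (- t) v in xiM imN.
have vw : v = teich_map t w by rewrite teich_mapVK.
clearbody w.
have qp : (0 : R) < q%:R by rewrite ltr0n.
have et : expR (t / 2) = q%:R by rewrite /t mulrAC divff// mul1r lnK ?posrE.
have wI : Im w = N%:~R by move: imN; rewrite !cplxE /= !(oppr0, addr0).
pose j : R := (if b' then 1 else 0) - (if b then 1 else 0).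
have wR : Re w = M%:~R + j * beta - N%:~R * alpha.
  move: xiM; rewrite xiD xiN xiD xiN !xi_branch_pt xiE wI /j.
  by case: (b) (b') => -[]; lra.
have vR : Re v = q%:R * (M%:~R + j * beta - N%:~R * alpha).
  by rewrite -wR -et vw.
have vI : Im v = q%:R^-1 * N%:~R by rewrite -wI -et -expRN vw.
have [] := normc_ge_ReIm v; rewrite vR vI.
set L := ComplexField.Normc.normc v => LR LI.
move: eps01 => /andP[ep e1].
(* At time [t] the lattice vector (- eta, q) becomes (- q eta, 1), whose coordinates are at most 1
   in absolute value; hence the factor 2. *)
have det : `|(q%:R * M%:~R - p%:~R * N%:~R) + j * (q%:R * beta)| <= 2 * L.
  set eta := q%:R * alpha - p%:~R.
  have -> : (q%:R * M%:~R - p%:~R * N%:~R) + j * (q%:R * beta) =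
     q%:R * (M%:~R + j * beta - N%:~R * alpha) + (q%:R^-1 * N%:~R) * (q%:R * eta).
    by rewrite /eta; field; rewrite gt_eqF.
  apply: le_trans (ler_normD _ _) _.
  have : `|q%:R^-1 * N%:~R * (q%:R * eta)| <= L.
    rewrite normrM; apply: le_trans (_ : `|q%:R^-1 * N%:~R| * 1 <= _); last by rewrite mulr1.
    by rewrite ler_wpM2l// ger0_norm// mulr_ge0.
  lra.
pose K : int := q%:Z * M - p * N.
have KE : q%:R * M%:~R - p%:~R * N%:~R = K%:~R :> R by rewrite /K intrB !intrM.
rewrite KE in det.
have [bb|bb] := boolP (b == b'); last first.
  suff : eps <= 2 * L by lra.
  apply: le_trans det; rewrite /j.
  case: (b) (b') bb => -[] //= _.
    rewrite sub0r mulN1r -normrN opprB; exact: beta_far.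
  rewrite subr0 mul1r addrC.
  by have := beta_far (- K); rewrite intrN opprK.
have j0 : j = 0 by rewrite /j (eqP bb) subrr.
rewrite j0 mul0r addr0 in det.
have [K0|K0] := eqVneq K 0; last first.
  have : 1 <= `|K%:~R| :> R by apply: norm_intr_ge1; rewrite ?intr_int// intr_eq0.
  lra.
have N0 : N != 0.
  apply/negP => /eqP N0; move: K0; rewrite /K N0 mulr0 subr0 => /eqP.
  rewrite mulf_eq0 => /orP[/eqP[]|/eqP M0]; first by move=> q0; move: q_gt0; rewrite q0.
  move/eqP : v0; apply; rewrite vw; apply/cplx_eqP => /=.
  by rewrite wR wI N0 M0 j0 !mul0r add0r subrr !mulr0.
(* The determinant vanishes, so the holonomy is a nonzero multiple of the lattice vector, and its
   deformed height N / q is a nonzero integer. *)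
have qN : (q %| N)%Z.
  rewrite -(Gauss_dvdzr _ (m := q) (n := p)) ?[coprimez q p]coprimez_sym//.
  by move/eqP : K0; rewrite subr_eq0 => /eqP <-; exact: dvdz_mulr.
have {qN} : (q%:R : R) <= `|N%:~R|.
  have qN' : (q <= `|N|)%N by apply: dvdn_leq; rewrite ?absz_gt0.
  by rewrite -intr_norm -abszE -pmulrn ler_nat.
move: LI; rewrite normrM gtr0_norm ?invr_gt0// => LI qN.
have : 1 <= q%:R^-1 * `|N%:~R| :> R by rewrite mulrC ler_pdivlMr// mul1r.
lra.
Qed.

Lemma teich_depth_le : teich_depth S t <= - 2 * ln (eps / 2).
Proof.
move: eps01 => /andP[ep e1].
have ep2 : 0 < eps / 2 by rewrite divr_gt0.
rewrite /teich_depth /shortest_saddle_length; set A := saddle_lengths _.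
rewrite ler_nM2l//.
have [A0|/set0P A0] := eqVneq A set0.
  (* Junk values, if there were no saddle connection. *)
  by rewrite A0 inf0 (ln0 (lexx 0)) ln_le0//; lra.
have leA : eps / 2 <= inf A.
  by apply: lb_le_inf => // l [v [gamma [sc ->]]]; exact: saddle_length_ge sc.
by rewrite ler_ln// posrE//; exact: lt_le_trans leA.
Qed.

End depth.

(** * The transfer functions *)

Section cocycle.
Context {R : realType}.
Variable alpha : R.
Variables (p : nat -> int) (q : nat -> nat).
Implicit Types (x y : R) (k j N : nat).

Definition eta k : R := (q k)%:R * alpha - (p k)%:~R.
Definition beta_sum N : R := \sum_(k < N) (2 * eta k).

(** The mod 2 sum of the indicators of [q k] rotates of an interval of length [eta k]. The offset
    [beta_sum k] makes the intervals of length [2 * eta k], whose indicators are the coboundaries,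
    abut one another. *)
Definition transfer_step k x : bool :=
  \big[addb/false]_(j < q k) (frac (x - beta_sum k - j%:R * alpha) < eta k).
Definition transfer N x : bool := \big[addb/false]_(k < N) transfer_step k x.

Lemma etaE k : eta k = (q k)%:R * alpha - (p k)%:~R. Proof. by []. Qed.

Lemma beta_sumE N : beta_sum N = \sum_(k < N) (2 * eta k). Proof. by []. Qed.

Lemma beta_sumS N : beta_sum N.+1 = beta_sum N + 2 * eta N.
Proof. by rewrite /beta_sum big_ord_recr. Qed.

Lemma telescope_addb (a : nat -> bool) n :
  \big[addb/false]_(j < n) a j (+) \big[addb/false]_(j < n) a j.+1 = a 0%N (+) a n.
Proof.
elim: n => [|n IH]; first by rewrite !big_ord0 !addbb.
rewrite !big_ord_recr /= addbACA IH.
by case: (a 0%N); case: (a n); case: (a n.+1).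
Qed.

Lemma frac_lt_split y e : 0 < e -> 2 * e <= 1 ->
  (frac y < e) (+) (frac (y - e) < e) = (frac y < 2 * e).
Proof.
move=> e0 e1; have y0 := frac_ge0 y; have y1 := frac_lt1 y.
have [ye|ye] := ltP (frac y) e.
  have -> : frac (y - e) = frac y - e + 1.
    apply: frac_uniq; first by alra.
    rewrite (_ : _ - _ = (y - frac y) - 1); last by ring.
    by apply: rpredB; [exact: sub_frac_int|exact: rpred1].
  have -> : (frac y - e + 1 < e) = false by apply/negbTE; rewrite -leNgt; lra.
  by rewrite /=; apply/esym/idP; lra.
have -> : frac (y - e) = frac y - e.
  apply: frac_uniq; first by alra.
  by rewrite (_ : _ - _ = y - frac y); [exact: sub_frac_int|ring].
by rewrite /=; apply/idP/idP; lra.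
Qed.

(** Adjacent intervals of the circle are disjoint, so addition mod 2 is their union. *)
Lemma frac_lt_shift x b e : 0 <= b -> 0 <= e -> b + e <= 1 ->
  (frac x < b) (+) (frac (x - b) < e) = (frac x < b + e).
Proof.
move=> b0 e0 be; have x0 := frac_ge0 x; have x1 := frac_lt1 x.
have [xb|xb] := ltP (frac x) b.
  have -> : frac (x - b) = frac x - b + 1.
    apply: frac_uniq; first by alra.
    rewrite (_ : _ - _ = (x - frac x) - 1); last by ring.
    by apply: rpredB; [exact: sub_frac_int|exact: rpred1].
  have -> : (frac x - b + 1 < e) = false by apply/negbTE; rewrite -leNgt; lra.
  by rewrite /=; apply/esym/idP; lra.
have -> : frac (x - b) = frac x - b.
  apply: frac_uniq; first by alra.
  by rewrite (_ : _ - _ = x - frac x); [exact: sub_frac_int|ring].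
by rewrite /=; apply/idP/idP; lra.
Qed.

Hypothesis eta_gt0 : forall k, 0 < eta k.

Lemma beta_sum_ge0 N : 0 <= beta_sum N.
Proof. by rewrite sumr_ge0// => k _; rewrite mulr_ge0// ltW. Qed.

Lemma beta_sum_homo M N : (M <= N)%N -> beta_sum M <= beta_sum N.
Proof.
move=> /subnK <-; elim: (N - M)%N => // n IH; apply: le_trans IH _.
by rewrite addSn beta_sumS lerDl mulr_ge0// ltW.
Qed.

Hypothesis beta_sum_le1 : forall N, beta_sum N <= 1.

(* Mod 1, [0, 2 eta k) is the union of [0, eta k) and its translate by
   q_k alpha, so its indicator is a coboundary mod 2. *)
Lemma transfer_stepE k x :
  transfer_step k x (+) transfer_step k (x - alpha) =
  (frac (x - beta_sum k) < 2 * eta k).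
Proof.
have e0 := eta_gt0 k; have B0 := beta_sum_ge0 k.
have B1 := beta_sum_le1 k.+1; rewrite beta_sumS in B1.
pose a j := frac (x - beta_sum k - j%:R * alpha) < eta k.
have -> : transfer_step k (x - alpha) = \big[addb/false]_(j < q k) a j.+1.
  apply: eq_bigr => j _; rewrite /a; congr (frac _ < _).
  by rewrite -[in RHS]natr1; ring.
rewrite (telescope_addb a) /a mul0r subr0 -frac_lt_split//; last by lra.
congr (_ (+) (_ < _)); apply/eqP; rewrite eq_frac /eta.
by rewrite (_ : _ - _ = - (p k)%:~R); [rewrite rpredN intr_int|ring].
Qed.

Lemma transfer_coboundary N x :
  transfer N x (+) transfer N (x - alpha) = (frac x < beta_sum N).
Proof.
rewrite /transfer; elim: N => [|N IH].
  by rewrite !big_ord0 /beta_sum big_ord0; apply/esym/negbTE; rewrite -leNgt frac_ge0.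
rewrite !big_ord_recr /= addbACA IH transfer_stepE beta_sumS frac_lt_shift//.
- exact: beta_sum_ge0.
- by rewrite mulr_ge0// ltW.
- by rewrite -beta_sumS.
Qed.

Lemma transfer_periodic N x m : m \is a Num.int -> transfer N (x + m) = transfer N x.
Proof.
move=> mz; apply: eq_bigr => k _; apply: eq_bigr => j _; congr (_ < _).
rewrite -(fracDz (x - beta_sum k - _) mz); congr frac; ring.
Qed.

Lemma eta_le1 k : eta k <= 1.
Proof.
have := beta_sum_le1 k.+1; rewrite beta_sumS.
have := beta_sum_ge0 k; have := eta_gt0 k; lra.
Qed.

Lemma measurable_frac_lt c (e : R) : e <= 1 ->
  measurable [set x : R | frac (x - c) < e].
Proof.
move=> e1.
have -> : [set x : R | frac (x - c) < e] =
    \bigcup_(m : int) `[c + m%:~R, c + m%:~R + e[%classic.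
  apply/seteqP; split=> x /=.
    move=> xe; exists (Num.floor (x - c)) => //; rewrite /= in_itv /=.
    by have := frac_ge0 (x - c); rewrite /frac in xe *; move=> ?; alra.
  move=> [m _]; rewrite /= in_itv /= => /andP[xl xu].
  have -> : frac (x - c) = x - c - m%:~R.
    apply: frac_uniq; first by alra.
    by rewrite opprB addrC subrK intr_int.
  lra.
apply: countable_bigcupT_measurable; first exact: countableP.
by move=> m; exact: measurable_itv.
Qed.

Lemma measurable_addb d (T : measurableType d) (a b : T -> bool) :
  measurable [set x | a x] -> measurable [set x | b x] ->
  measurable [set x | a x (+) b x].
Proof.
move=> am bm.
rewrite (_ : [set x | a x (+) b x] = ([set x | a x] `\` [set x | b x]) `|`
    ([set x | b x] `\` [set x | a x])).
  by apply: measurableU; exact: measurableD.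
apply/seteqP; split=> x /=; case: (a x) (b x) => -[] //=; try by [left|right].
- by case=> -[].
- by case=> -[].
Qed.

Lemma measurable_big_addb d (T : measurableType d) n (a : nat -> T -> bool) :
  (forall j, measurable [set x | a j x]) ->
  measurable [set x | \big[addb/false]_(j < n) a j x].
Proof.
move=> am; elim: n => [|n IH].
  by rewrite (_ : [set x | _] = set0)//; apply/seteqP; split=> x //=; rewrite big_ord0.
rewrite (_ : [set x | _] = [set x | \big[addb/false]_(j < n) a j x (+) a n x]).
  exact: measurable_addb.
by apply/seteqP; split=> x /=; rewrite big_ord_recr.
Qed.

Lemma measurable_transfer N : measurable [set x : R | transfer N x].
Proof.
apply: (@measurable_big_addb _ _ N transfer_step) => k.
apply: (@measurable_big_addb _ _ (q k)
  (fun j x => frac (x - beta_sum k - j%:R * alpha) < eta k)) => j.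
rewrite (_ : [set x | _] = [set x : R | frac (x - (beta_sum k + j%:R * alpha)) < eta k]).
  by apply: measurable_frac_lt; exact: eta_le1.
by apply/seteqP; split=> x /=; rewrite opprD addrA.
Qed.

(** The pointwise limit of the transfer functions, encoded by the sets where they stabilize. *)
Definition eventually_transfer (c : bool) : set R :=
  [set x | exists N0, forall N, (N0 <= N)%N -> transfer N x = c].

Lemma measurable_eventually_transfer c : measurable (eventually_transfer c).
Proof.
have -> : eventually_transfer c = \bigcup_N0 \bigcap_N
    [set x | (N0 <= N)%N -> transfer N x = c].
  apply/seteqP; split=> x /= [N0]; first by move=> H; exists N0 => // N _ /=; exact: H.
  by move=> _ H; exists N0 => N; exact: H.
apply: bigcupT_measurable => N0; apply: bigcapT_measurable => N.
have [N0N|N0N] := leqP N0 N; last first.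
  by rewrite (_ : [set x | _] = setT)//; apply/seteqP; split=> x.
rewrite (_ : [set x | _] = if c then [set x | transfer N x] else ~` [set x | transfer N x]).
  by case: c; [exact: measurable_transfer|apply: measurableC; exact: measurable_transfer].
case: c; apply/seteqP; split=> x /=.
- by move=> H; rewrite H.
- by move=> H _.
- by move=> -> //.
- by move=> H _; apply/negP.
Qed.

Hypothesis eta_small : forall k, (q k)%:R * eta k <= (2 ^+ (k + 4))^-1.

(** All transfer functions vanish here, so above these points the invariant set contains one sheet
    and misses the other. This set thus gives positive area on both sides. *)
Definition quiet : set R :=
  [set x | 0 < x < 1 /\ forall k, transfer_step k x = false].

Lemma quiet_transfer N x : quiet x -> transfer N x = false.
Proof. by move=> [_ xq]; rewrite /transfer big1. Qed.

Lemma measurable_quiet : measurable quiet.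
Proof.
have -> : quiet = `]0, 1[%classic `&` \bigcap_k ~` [set x | transfer_step k x].
  apply/seteqP; split=> x /=.
    by move=> [x01 xq]; split; [rewrite in_itv|move=> k _ /=; rewrite xq].
  rewrite in_itv => -[x01 xq]; split=> // k.
  by apply/negP; exact: xq.
apply: measurableI; first exact: measurable_itv.
apply: bigcapT_measurable => k; apply: measurableC.
apply: (@measurable_big_addb _ _ (q k)
  (fun j x => frac (x - beta_sum k - j%:R * alpha) < eta k)) => j.
rewrite (_ : [set x | _] = [set x : R | frac (x - (beta_sum k + j%:R * alpha)) < eta k]).
  by apply: measurable_frac_lt; exact: eta_le1.
by apply/seteqP; split=> x /=; rewrite opprD addrA.
Qed.

(** The factor 2 is crude: it counts both translates of an interval of length [e] that can meet the
    unit interval. *)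
Lemma frac_lt_measure c (e : R) : 0 < e <= 1 ->
  (lebesgue_measure ([set x : R | (frac (x - c) < e)%R] `&` `]0%R, 1%R[%classic)
   <= (2 * e)%:E)%E.
Proof.
move=> /andP[e0 e1].
pose c0 := frac c.
have sub : [set x : R | frac (x - c) < e] `&` `]0, 1[ `<=`
    `[c0, c0 + e[%classic `|` `[c0 - 1, c0 - 1 + e[%classic.
  move=> x [/= xe]; rewrite !in_itv /= => /andP[x0 x1].
  have c00 := frac_ge0 c; have c01 := frac_lt1 c; rewrite -/c0 in c00 c01.
  have cz : c - c0 \is a Num.int := sub_frac_int c.
  have [xc|xc] := leP c0 x; [left|right].
    move: xe; rewrite (_ : frac (x - c) = x - c0); first by move=> ?; alra.
    apply: frac_uniq; first by alra.
    by rewrite (_ : _ - _ = - (c - c0)); [rewrite rpredN|ring].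
  move: xe; rewrite (_ : frac (x - c) = x - c0 + 1); first by move=> ?; alra.
  apply: frac_uniq; first by alra.
  rewrite (_ : _ - _ = - (c - c0) - 1); last by ring.
  by apply: rpredB; [rewrite rpredN|exact: rpred1].
have itvE (a : R) : lebesgue_measure (`[a, (a + e)%R[%classic : set R) = e%:E.
  rewrite lebesgue_measure_itv /= lte_fin ltrDl e0 -EFinD.
  by congr _%:E; lra.
apply: le_trans (_ : (lebesgue_measure (`[c0, (c0 + e)%R[%classic `|`
    `[(c0 - 1)%R, (c0 - 1 + e)%R[%classic : set R) <= _)%E).
  apply: le_measure => //; rewrite ?inE.
    by apply: measurableI; [exact: measurable_frac_lt|exact: measurable_itv].
  by apply: measurableU; exact: measurable_itv.
apply: (@le_trans _ _ (lebesgue_measure (`[c0, (c0 + e)%R[%classic : set R) +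
    lebesgue_measure (`[(c0 - 1)%R, (c0 - 1 + e)%R[%classic : set R))%E).
  by apply: measureU2; exact: measurable_itv.
by rewrite !itvE -EFinD lee_fin; lra.
Qed.

(** Step k is supported on measure at most 2 q_k eta_k <= 2^-(k+3) <= 2^-(k+2), and the last bounds
    add up to 1/2. *)
Lemma quiet_measure_gt0 : (0 < lebesgue_measure quiet)%E.
Proof.
pose U k j : set R := [set x | frac (x - (beta_sum k + j%:R * alpha)) < eta k] `&` `]0, 1[.
have Um k j : measurable (U k j).
  by apply: measurableI; [apply: measurable_frac_lt; exact: eta_le1|exact: measurable_itv].
pose V k : set R := \big[setU/set0]_(j < q k) U k j.
have Vm k : measurable (V k) by apply: bigsetU_measurable => j _; exact: Um.
have V_le k : (lebesgue_measure (V k) <= (2^-1 / (2 ^ k.+1)%:R)%:E)%E.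
  have B := @Boole_inequality _ _ _ lebesgue_measure (U k) (q k) (fun j _ => Um k j).
  apply: (le_trans B).
  apply: (@le_trans _ _ (\sum_(j < q k) (2 * eta k)%:E)%E).
    apply: lee_sum => j _; apply: frac_lt_measure.
    by rewrite eta_gt0 eta_le1.
  rewrite sumEFin lee_fin sumr_const card_ord -[_ *+ q k]mulr_natl natrX.
  have P0 : 0 < (2 : R) ^+ k by rewrite exprn_gt0.
  have -> : 2^-1 / 2 ^+ k.+1 = 4 * (2 ^+ (k + 4))^-1 :> R.
    by rewrite exprD exprS; field; rewrite gt_eqF.
  have : 0 < (2 ^+ (k + 4))^-1 :> R by rewrite invr_gt0 exprn_gt0.
  have := eta_small k; rewrite mulrCA; lra.
have cov : `]0, 1[%classic `<=` quiet `|` \bigcup_k V k.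
  move=> x /=; rewrite in_itv /= => x01.
  have [[k xk]|xq] := pselect (exists k, transfer_step k x).
    right; exists k => //; rewrite /V -bigcup_mkord.
    apply: contrapT => nU; move: xk; rewrite /transfer_step big1// => j _.
    apply/negbTE/negP => xj; apply: nU; exists j => //=.
    by split; rewrite /= ?in_itv//= opprD addrA.
  by left; split=> // k; apply/negP => xk; apply: xq; exists k.
have VUm : measurable (\bigcup_k V k) by exact: bigcupT_measurable.
have VU_le : (lebesgue_measure (\bigcup_k V k) <= (2^-1)%:E)%E.
  have GB := @generalized_Boole_inequality _ _ _ lebesgue_measure V Vm VUm.
  apply: (le_trans GB).
  apply: (@le_trans _ _ (\sum_(0 <= i <oo) (0 + (2^-1 / (2 ^ i.+1)%:R)%:E))%E).
    apply: lee_nneseries => k *; first exact: measure_ge0.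
    by rewrite add0e; exact: V_le.
  have half0 : (0 : R) <= 2^-1 by rewrite invr_ge0.
  apply: (le_trans (@epsilon_trick R (fun=> 0%E) 2^-1 xpredT (fun=> lexx _) half0)).
  by rewrite eseries0// add0e.
rewrite ltNge; apply/negP => q0.
have : (lebesgue_measure (`]0%R, 1%R[%classic : set R) <= (2^-1)%:E)%E.
  apply: (@le_trans _ _ (lebesgue_measure (quiet `|` \bigcup_k V k))).
    apply: le_measure => //; rewrite inE; first exact: measurable_itv.
    by apply: measurableU => //; exact: measurable_quiet.
  apply: (@le_trans _ _ (lebesgue_measure quiet + lebesgue_measure (\bigcup_k V k))%E).
    by apply: measureU2 => //; exact: measurable_quiet.
  by rewrite -[leRHS]add0e leeD.
rewrite lebesgue_measure_itv /= lte_fin ltr01 -EFinD lee_fin; lra.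
Qed.

End cocycle.

(** * The invariant set *)

Section borel.
Context {T : topologicalType}.

Lemma borel_open (U : set T) : open U -> borel U.
Proof. by move=> oU; apply: sub_gen_smallest. Qed.

Lemma borel_sigma : sigma_algebra [set: T] (@borel T).
Proof. exact: smallest_sigma_algebra. Qed.

Lemma borelC (U : set T) : borel U -> borel (~` U).
Proof. by move=> bU; rewrite -setTD; have [_ + _] := borel_sigma; exact. Qed.

Lemma borel_bigcup (F : nat -> set T) : (forall n, borel (F n)) -> borel (\bigcup_n F n).
Proof. by have [_ _] := borel_sigma; exact. Qed.

Lemma borelU (U V : set T) : borel U -> borel V -> borel (U `|` V).
Proof.
move=> bU bV; rewrite -bigcup2E; apply: borel_bigcup => -[|[|n]] //=.
by have [] := borel_sigma.
Qed.

Lemma borelD (U V : set T) : borel U -> borel V -> borel (U `\` V).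
Proof.
move=> bU bV; rewrite setDE -[U]setCK -setCU; apply: borelC.
by apply: borelU => //; exact: borelC.
Qed.

End borel.

Lemma plane_area0 (R : realType) : plane_area (set0 : set (cplx R)) = 0%E.
Proof. by rewrite /plane_area image_set0 measure0. Qed.

Lemma area_set0 (R : realType) (X : topologicalType) (F : flat_structure R X) :
  area F set0 = 0%E.
Proof.
apply/eqP; rewrite eq_le; apply/andP; split.
  apply: ge_ereal_sup => _ [n [B [phi [BA _ _ ->]]]].
  rewrite big1// => i _; have [_] := BA i.
  by rewrite subset0 => ->; rewrite image_set0 plane_area0.
apply: ereal_sup_ubound; exists 0%N, (fun=> set0), (fun=> LocalParam set0 (fun=> 0)).
split; [by case|by move=> []|by case|by rewrite big_ord0].
Qed.

Lemma borel_area_measurable (R : realType) (X : topologicalType)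
    (F : flat_structure R X) (A : set X) : borel A -> area_measurable F A.
Proof. by move=> bA; exists A, A; split=> //; rewrite setDv area_set0. Qed.

Lemma area_ge (R : realType) (X : topologicalType) (F : flat_structure R X)
    (A B : set X) (phi : local_param R X) :
  borel B -> B `<=` A -> natural F phi -> B `<=` dom phi ->
  (plane_area (phi @` B) <= area F A)%E.
Proof.
move=> bB BA nphi Bphi; apply: ereal_sup_ubound.
exists 1%N, (fun=> B), (fun=> phi); split=> //.
  by move=> i j _ _ _; rewrite (ord1 i) (ord1 j).
by rewrite big_ord1.
Qed.

(** Since [teich_map 0] is the identity, [straight_local] also applies to vertical leaves. *)
Lemma straight_teich0 (R : realType) (X : Type) (F : flat_structure R X) v a b gamma :
  straight F v a b gamma -> straight (teich 0 F) v a b gamma.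
Proof.
move=> st s sab; have [ns loc] := st s sab; split=> // _ [phi nphi <-] dphi.
have E z : teich_map 0 z = z :> cplx R.
  by case: z => x y; rewrite /teich_map mul0r oppr0 expR0 !mul1r.
by apply: filterS (loc phi nphi dphi) => u; rewrite /= !E.
Qed.

Section invariant_set.
Context {R : realType}.
Variables alpha beta : R.
Variables (p : nat -> int) (q : nat -> nat).
Hypothesis beta01 : 0 < beta < 1.
Implicit Types (z w u h : cplx R) (c s : bool).

Local Notation lattice := (lattice alpha).
Local Notation branch := (branch alpha beta).
Local Notation cover := (cover alpha beta).
Local Notation pt := (pt alpha beta).
Local Notation rect := (rect beta).
Local Notation S := (slit_cover alpha beta01).
Local Notation eta := (eta alpha p q).
Local Notation beta_sum := (beta_sum alpha p q).
Local Notation transfer := (transfer alpha p q).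
Local Notation eventually_transfer := (eventually_transfer alpha p q).
Local Notation quiet := (quiet alpha p q).

Hypothesis eta_gt0 : forall k, 0 < eta k.
Hypothesis eta_small : forall k, (q k)%:R * eta k <= (2 ^+ (k + 4))^-1.
Hypothesis beta_sum_le : forall N, beta_sum N <= beta.
Hypothesis beta_sum_cvg : forall x, x < beta -> exists N, x < beta_sum N.

Let beta_sum_le1 N : beta_sum N <= 1.
Proof. by apply: le_trans (beta_sum_le N) _; case/andP : beta01 => _ /ltW. Qed.

Lemma beta_sum_eventually x : exists N0, forall N, (N0 <= N)%N ->
  (x < beta_sum N) = (x < beta).
Proof.
have [xb|xb] := ltP x beta.
  have [N0 xN0] := beta_sum_cvg xb; exists N0 => N /(beta_sum_homo eta_gt0).
  exact: lt_le_trans.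
by exists 0%N => N _; apply/negbTE; rewrite -leNgt (le_trans _ xb).
Qed.

(* The transfer function is carried upwards along the vertical lines. *)
Definition height_transfer N z : bool :=
  transfer N (Re z + (Num.floor (Im z))%:~R * alpha).

(** The floor term cancels the horizontal drift of the lattice, leaving a shift by the integer
    [xi (z - w)]. *)
Lemma height_transfer_lattice N z w : lattice (z - w) ->
  height_transfer N z = height_transfer N w.
Proof.
move=> l; have := l; rewrite latticeE => /andP[xz]; rewrite ImD ImN => yz.
rewrite /height_transfer.
rewrite -(subrK (Im w) (Im z)) floorDzr// intrD.
have -> : (Num.floor (Im z - Im w))%:~R = Im z - Im w.
  by apply/eqP; rewrite -intrEfloor.
set f := Num.floor (Im w).
rewrite (_ : Re z + _ = Re w + f%:~R * alpha + (xi alpha (z - w))).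
  exact: transfer_periodic.
by rewrite xiE !cplxE; ring.
Qed.

Definition invariant_set : set cover := [set x | exists z s,
  [/\ x = pt z s, ~~ branch z &
      exists N0, forall N, (N0 <= N)%N -> s = height_transfer N z]].

Lemma invariant_setP z s : ~~ branch z ->
  invariant_set (pt z s) <->
  exists N0, forall N, (N0 <= N)%N -> s = height_transfer N z.
Proof.
move=> bz; split=> [[w [t [/pt_eqP[zw bst] bw [N0 H]]]]|H]; last by exists z, s.
exists N0 => N N0N; case: bst => [b|->]; first by rewrite b in bz.
by rewrite (H N N0N) (height_transfer_lattice N zw).
Qed.

(** Below the line Im z = 0 the argument becomes Re z - alpha. By the coboundary equation the value
    changes by the indicator of [0, beta_sum N), which at the given point is eventually that of [0,
    beta): exactly the exchange of sheets across the slit. *)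
Lemma height_transfer_rect n z : rect n z -> exists N0, forall N, (N0 <= N)%N ->
  height_transfer N z = transfer N (Re z) (+) ((n == 2)%N && (Im z < 0)).
Proof.
move=> nz; have [Rez Imz] := nz; rewrite /height_transfer.
have floor_eq0 : 0 <= Im z < 1 -> Num.floor (Im z) = 0.
  by move=> ?; apply: floor_def; rewrite add0r.
have [n2|n2] := ltnP n 2.
  exists 0%N => N _; rewrite floor_eq0.
    by rewrite mul0r addr0; case: n n2 {nz Rez Imz} => [|[|]] //; rewrite addbF.
  by move: Imz; rewrite /rect_bot n2 add0r => /andP[/ltW -> ->].
move: Imz; rewrite /rect_bot ltnNge n2 /= => /andP[y0 y1].
have [zp|zn] := leP 0 (Im z).
  exists 0%N => N _; rewrite floor_eq0; first by rewrite mul0r addr0 andbF addbF.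
  by rewrite zp; lra.
rewrite andbT.
have -> : Num.floor (Im z) = -1.
  by apply: floor_def; rewrite addNr /= intrN; alra.
have [N0 H] := beta_sum_eventually (Re z); exists N0 => N N0N.
rewrite mulN1r -[LHS](addbK (transfer N (Re z))) addbC.
rewrite [transfer N (_ - _) (+) _]addbC (transfer_coboundary eta_gt0 beta_sum_le1).
congr (_ (+) _); case/andP : beta01 => b0 b1.
have fz : frac (Re z) = Re z.
  apply: frac_id; move: Rez; rewrite /rect_lo /rect_hi.
  by case: n n2 {nz} => [|[|[|[|n]]]] //= _; rewrite ?nth_nil => /andP[? ?]; alra.
rewrite fz H//; move: Rez; rewrite /rect_lo /rect_hi.
case: n n2 {nz} => [|[|[|[|n]]]] //= _; rewrite ?nth_nil => /andP[x0 x1] //.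
  by rewrite (lt_gtF x0).
lra.
Qed.

(** The sheet change in [rect_sheet] cancels the one in [height_transfer_rect], so membership
    depends on [Re z] alone. Invariance and measurability both come from this. *)
Lemma invariant_set_rect n c z : rect n z ->
  invariant_set (pt z (rect_sheet n c z)) <-> eventually_transfer c (Re z).
Proof.
move=> nz; have [bz _] := rect_slit alpha beta01 nz; rewrite (invariant_setP _ bz).
have [N1 H1] := height_transfer_rect nz.
split=> -[N0 H0]; exists (maxn N0 N1) => N; rewrite geq_max => /andP[/H0 e0 /H1 e1].
  move: e0; rewrite /rect_sheet e1; set d := (_ && _).
  by case: (c); case: (d); case: (transfer N _).
by rewrite e1 e0.
Qed.

Lemma invariant_set_leaves : union_of_leaves (flat S) invariant_set.
Proof.
move=> x Ax _ y [a [b [gamma [st [s [u [sab uab gs gu]]]]]]].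
rewrite -gu; rewrite -gs in Ax.
pose P r := invariant_set (gamma r).
suff loc : forall r, a < r < b -> \forall r' \near r, P r' <-> P r.
  exact: (locally_constant_itv loc sab uab Ax).
move=> r rab.
have [n [z [c [nz zloc]]]] := straight_local (straight_teich0 st) rab.
have gr : gamma r = pt z (rect_sheet n c z).
  by have [_] := nbhs_singleton zloc; rewrite subrr mul0r addr0.
apply: filterS zloc => r' /= [nz' gr'].
rewrite /P gr gr' invariant_set_rect// invariant_set_rect//.
by rewrite ReD (_ : Re (_ * _) = 0) ?addr0//= !(mul0r, mulr0, subr0, mulr1).
Qed.

Let strip n c (W : set R) : set cover :=
  [set pt z (rect_sheet n c z) | z in [set z | rect n z /\ W (Re z)]].

(** The sets with a Borel strip form a sigma-algebra, complements being handled by injectivity of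
    the chart. It contains the open rays, which generate the measurable sets of [R]. *)
Lemma borel_strip n c W : measurable W -> borel (strip n c W).
Proof.
have gD := good_rect alpha beta01 n c.
have inj z w : rect n z -> rect n w ->
    pt z (rect_sheet n c z) = pt w (rect_sheet n c w) -> z = w.
  exact: (good_inj gD).
have op (W' : set R) : open W' -> borel (strip n c W').
  move=> oW; apply: borel_open.
  apply: (good_image_open beta01 gD) => [|z []//].
  apply: openI; first exact: rect_open.
  by apply: open_comp oW => z _; exact: Re_continuous.
have -> : measurable W = (@measurable_realfun.RGenOInfty.G R).-sigma.-measurable W.
  by rewrite -measurable_realfun.RGenOInfty.measurableE.
suff sigma : sigma_algebra setT [set W | borel (strip n c W)].
  apply: (smallest_sub sigma) => _ [x ->] /=; apply: op.
  exact: interval_open.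
split.
- exact: (op set0 open0).
- move=> W' bW'; change (borel (strip n c (setT `\` W'))).
  rewrite (_ : strip n c _ = strip n c setT `\` strip n c W').
    by apply: borelD => //; exact: (op setT openT).
  apply/seteqP; split=> x.
    move=> [z [nz [_ Wz]] <-]; split; first by exists z.
    by move=> [w [nw Ww] /(inj _ _ nw nz) wz]; apply: Wz; rewrite -wz.
  move=> [[z [nz _] <-] nW]; exists z => //; split=> //; split=> // Wz.
  by apply: nW; exists z.
- move=> F bF; change (borel (strip n c (\bigcup_k F k))).
  rewrite (_ : strip n c _ = \bigcup_k strip n c (F k)).
    exact: borel_bigcup.
  apply/seteqP; split=> x.
    by move=> [z [nz [k _ Fz]] <-]; exists k => //; exists z.
  by move=> [k _ [z [nz Fz] <-]]; exists z => //; split=> //; exists k.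
Qed.

Lemma borel_invariant_set : borel invariant_set.
Proof.
have -> : invariant_set = \bigcup_n
    (strip n false (eventually_transfer false) `|` strip n true (eventually_transfer true)).
  apply/seteqP; split=> x.
    move=> Ax; have [z [s [xE bz _]]] := Ax.
    have [n [w [c [_ nw zw]]]] := regular_cover beta01 s bz.
    move: Ax; rewrite xE zw (invariant_set_rect c nw) => Ac.
    by exists n => //; case: c Ac {zw} => Ac; [right|left]; exists w.
  by move=> [n _ [] [z [nz Wz] <-]]; apply/invariant_set_rect.
apply: borel_bigcup => n; apply: borelU; apply: borel_strip;
  exact: (measurable_eventually_transfer eta_gt0 beta_sum_le1).
Qed.

Lemma quiet_area_gt0 c A : strip 0 c quiet `<=` A -> (0 < area (flat S) A)%E.
Proof.
move=> sA; have gD := good_rect alpha beta01 0 c.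
have mq := measurable_quiet eta_gt0 beta_sum_le1.
pose phi : local_param R S := cover_chart alpha beta None (rect 0) (rect_sheet 0 c).
apply: lt_le_trans (area_ge (phi := phi) (borel_strip 0 c mq) sA _ _); last first.
- by move=> _ [z [nz _] <-]; exists z.
- exact: natural_good.
have -> : phi @` strip 0 c quiet = [set z | rect 0 z /\ quiet (Re z)].
  apply/seteqP; split=> z.
    by move=> [_ [w [nw qw] <-] <-]; rewrite [phi _](chartK gD).
  by move=> [nz qz]; exists (pt z (rect_sheet 0 c z)); [exists z|exact: (chartK gD)].
rewrite /plane_area.
have -> : [set (Re z, Im z) | z in [set z : cplx R | rect 0 z /\ quiet (Re z)]] =
    quiet `*` `]0, 1[%classic.
  apply/seteqP; split=> [_ [z [[_ Imz] qz] <-]|[x y] /= [qx]].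
    split=> //=; rewrite in_itv /=; move: Imz; rewrite /rect_bot /= add0r.
    exact.
  rewrite in_itv /= => y01; exists (x +i* y) => //; split=> //.
  by split; rewrite /rect_lo /rect_hi /rect_bot /= ?add0r//; case: qx.
have m01 : measurable (`]0, 1[%classic : set R) by exact: measurable_itv.
have m1 : (0 < lebesgue_measure (`]0%R, 1%R[%classic : set R))%E.
  by rewrite lebesgue_measure_itv /= lte_fin ltr01 -EFinD lte_fin subr0 ltr01.
rewrite product_measure1E//.
apply: mule_gt0; first exact: (quiet_measure_gt0 eta_gt0 beta_sum_le1 eta_small).
exact: m1.
Qed.

Lemma slit_cover_nonergodic : vertical_nonergodic (flat S).
Proof.
exists invariant_set; split.
- exact: borel_area_measurable borel_invariant_set.
- exact: invariant_set_leaves.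
- apply: (@quiet_area_gt0 false) => _ [z [nz qz] <-].
  by apply/invariant_set_rect => //; exists 0%N => N _; exact: quiet_transfer.
- apply: (@quiet_area_gt0 true) => _ [z [nz qz] <-].
  move=> /(invariant_set_rect _ nz)[N0 /(_ N0 (leqnn _))].
  by rewrite quiet_transfer.
Qed.

End invariant_set.

(** * Choice of the slit and of the direction *)

Section slit_length.
Context {R : realType}.
Variables (alpha : R) (p : nat -> int) (q : nat -> nat).
Implicit Types (x : R) (k m N j : nat).
Local Notation eta := (eta alpha p q).
Local Notation beta_sum := (beta_sum alpha p q).

Hypothesis q_gt0 : forall k, (0 < q k)%N.
Hypothesis q_double : forall k, (2 * q k <= q k.+1)%N.
Hypothesis eta_ge : forall k, (2 ^+ (k + 5))^-1 <= (q k)%:R * eta k.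
Hypothesis eta_le : forall k, (q k)%:R * eta k <= (2 ^+ (k + 4))^-1.

Let qR_gt0 k : (0 : R) < (q k)%:R. Proof. by rewrite ltr0n. Qed.

Lemma q_homo m k : (m <= k)%N -> (q m <= q k)%N.
Proof.
move=> /subnK <-; elim: (k - m)%N => // n IH; rewrite addSn.
by apply: leq_trans (q_double _); apply: (leq_trans IH); rewrite leq_pmull.
Qed.

Lemma q_eta_gt0 k : 0 < eta k.
Proof.
rewrite -(pmulr_rgt0 _ (qR_gt0 k)); apply: lt_le_trans (eta_ge k).
by rewrite invr_gt0 exprn_gt0.
Qed.

Lemma pow2S n : (2 ^+ n.+1)^-1 = (2 ^+ n)^-1 / 2 :> R.
Proof. by rewrite exprS invfM mulrC. Qed.

(** For k > m, q_m (2 eta_k) <= q_k (2 eta_k) <= 2^-(k+3). The right-hand side is the exact finite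
    geometric sum, which makes the induction close. *)
Lemma beta_sum_tail m j :
  (q m)%:R * (beta_sum (m.+1 + j) - beta_sum m.+1) <=
  (2 ^+ (m + 3))^-1 - (2 ^+ (m + j + 3))^-1.
Proof.
elim: j => [|j IH]; first by rewrite !addn0 !subrr mulr0.
rewrite addnS beta_sumS.
have e0 := q_eta_gt0 (m.+1 + j).
have qq : (q m)%:R * eta (m.+1 + j) <= (2 ^+ ((m.+1 + j) + 4))^-1.
  apply: le_trans (eta_le _); rewrite ler_pM2r// ler_nat.
  by apply: q_homo; lia.
rewrite (_ : m.+1 + j + 4 = (m + j + 3).+2)%N in qq; last by lia.
rewrite (_ : m + j.+1 + 3 = (m + j + 3).+1)%N; last by lia.
rewrite !pow2S in qq *; set P := (2 ^+ (m + j + 3))^-1 in IH qq *.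
lra.
Qed.

Definition slit_length : R := sup (range beta_sum).

Lemma beta_sum0 : beta_sum 0 = 0.
Proof. by rewrite beta_sumE big_ord0. Qed.

Lemma beta_sum_bound N : beta_sum N <= 4^-1.
Proof.
case: N => [|j]; first by rewrite beta_sum0.
have q1 : (1 : R) <= (q 0)%:R by rewrite ler1n.
have := beta_sum_tail 0 j; rewrite !add0n add1n.
have : beta_sum 1 <= 2 * (2 ^+ 4)^-1.
  rewrite beta_sumS beta_sum0 add0r ler_pM2l//.
  apply: le_trans (eta_le 0); rewrite -[leLHS]mul1r ler_pM2r//; exact: q_eta_gt0.
have : 0 < (2 ^+ (j + 3))^-1 :> R by rewrite invr_gt0 exprn_gt0.
have mono : 0 <= beta_sum j.+1 - beta_sum 1.
  by rewrite subr_ge0 beta_sum_homo//; exact: q_eta_gt0.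
have : beta_sum j.+1 - beta_sum 1 <= (q 0)%:R * (beta_sum j.+1 - beta_sum 1).
  by rewrite ler_peMl.
rewrite !exprS expr0; lra.
Qed.

Lemma beta_sum_has_sup : has_sup (range beta_sum).
Proof.
split; first by exists (beta_sum 0), 0%N.
by exists 4^-1 => _ [N _ <-]; exact: beta_sum_bound.
Qed.

Lemma beta_sum_le_slit N : beta_sum N <= slit_length.
Proof. by apply: sup_upper_bound; [exact: beta_sum_has_sup|exists N]. Qed.

Lemma beta_sum_lt_slit x : x < slit_length -> exists N, x < beta_sum N.
Proof.
move=> xs; have := sup_adherent (eps := slit_length - x) _ beta_sum_has_sup.
rewrite subr_gt0 => /(_ xs)[_ [N _ <-]]; rewrite opprB addrC subrK => ?.
by exists N.
Qed.

Lemma slit_length_itv : 0 < slit_length < 1.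
Proof.
apply/andP; split.
  apply: lt_le_trans (beta_sum_le_slit 1).
  by rewrite beta_sumS beta_sum0 add0r mulr_gt0// q_eta_gt0.
apply: (@le_lt_trans _ _ 4^-1); last by lra.
by apply: sup_le_ub => [|_ [N _ <-]]; [exists (beta_sum 0), 0%N|exact: beta_sum_bound].
Qed.

Lemma slit_length_tail m :
  (q m)%:R * (slit_length - beta_sum m.+1) <= (2 ^+ (m + 3))^-1.
Proof.
rewrite mulrC -ler_pdivlMr// lerBlDr.
apply: sup_le_ub => [|_ [N _ <-]]; first by exists (beta_sum 0), 0%N.
have h : 0 < (2 ^+ (m + 3))^-1 :> R by rewrite invr_gt0 exprn_gt0.
have [Nm|mN] := leqP N m.+1.
  apply: (@le_trans _ _ (beta_sum m.+1)); last by rewrite lerDr ltW// divr_gt0.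
  by apply: beta_sum_homo => //; exact: q_eta_gt0.
rewrite -lerBlDr ler_pdivlMr// mulrC.
have := beta_sum_tail m (N - m.+1); rewrite subnKC ?(ltnW mN)//.
move/le_trans; apply; rewrite gerDl oppr_le0 invr_ge0 exprn_ge0//.
Qed.

(** Eliminating alpha, q_m eta_k = q_k eta_m + (q_k p_m - q_m p_k). *)
Lemma q_beta_sum m N : exists K : int, (q m)%:R * beta_sum N =
  K%:~R + 2 * eta m * (\sum_(k < N) q k)%N%:R.
Proof.
elim: N => [|N [K IH]]; first by exists 0; rewrite big_ord0 beta_sum0 !mulr0 addr0.
exists (K + 2 * ((q N)%:Z * p m - (q m)%:Z * p N)).
rewrite beta_sumS big_ord_recr /= mulrDr IH natrD intrD intrM intrB !intrM.
rewrite !etaE; ring.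
Qed.

Lemma sum_q_le m : (\sum_(k < m) q k <= q m)%N.
Proof.
elim: m => [|m IH]; first by rewrite big_ord0.
rewrite big_ord_recr /=; apply: leq_trans (q_double m).
by rewrite mul2n -addnn leq_add2r.
Qed.

(** Mod 1, q_m beta is the sum of an earlier part between 0 and 2 q_m eta_m, the term 2 q_m eta_m >=
    2^-(m+4), and a tail between 0 and 2^-(m+3). The total is at most 1/2, so 0 is the nearest
    integer. *)
Lemma slit_length_far m (n : int) :
  (2 ^+ (m + 4))^-1 <= `|(q m)%:R * slit_length - n%:~R|.
Proof.
have [K KE] := q_beta_sum m m.
have tail := slit_length_tail m; rewrite beta_sumS in tail.
have tail0 := beta_sum_le_slit m.+1; rewrite beta_sumS in tail0.
have e0 := q_eta_gt0 m; have qR := qR_gt0 m.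
pose s : R := (\sum_(k < m) q k)%N%:R.
have s0 : 0 <= s by rewrite ler0n.
have sq : s <= (q m)%:R by rewrite ler_nat sum_q_le.
have lo := eta_ge m; have hi := eta_le m.
have P0 : 0 < (2 ^+ m)^-1 :> R by rewrite invr_gt0 exprn_gt0.
have P1 : (2 ^+ m)^-1 <= 1 :> R by rewrite invf_le1 ?exprn_gt0// exprn_ege1// ler1n.
rewrite !addnS !addn0 !pow2S in lo hi tail *; set P := (2 ^+ m)^-1 in P0 P1 lo hi tail *.
set f := (q m)%:R * slit_length - K%:~R.
have fE : f = 2 * eta m * s + 2 * ((q m)%:R * eta m) +
    (q m)%:R * (slit_length - (beta_sum m + 2 * eta m)).
  have -> : f = (q m)%:R * slit_length -
      ((q m)%:R * beta_sum m - 2 * eta m * s) by rewrite KE /f /s; ring.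
  ring.
have se : 0 <= eta m * s <= (q m)%:R * eta m.
  apply/andP; split; first by apply: mulr_ge0 => //; exact: ltW.
  by rewrite mulrC ler_pM2r.
have t0 : 0 <= (q m)%:R * (slit_length - (beta_sum m + 2 * eta m)).
  by apply: mulr_ge0; [exact: ltW|rewrite subr_ge0].
have f_lo : P / 2 / 2 / 2 / 2 <= f by rewrite fE; move/andP : se => [? ?]; lra.
have f_hi : f <= 1 / 2 by rewrite fE; move/andP : se => [? ?]; lra.
have -> : (q m)%:R * slit_length - n%:~R = f - (n - K)%:~R.
  by rewrite /f intrB; ring.
have [nK|nK] := lerP (n - K) 0.
  have : ((n - K)%:~R : R) <= 0 by rewrite lerz0.
  by move=> ?; rewrite ger0_norm; lra.
have : (1 : R) <= (n - K)%:~R by rewrite ler1z -gtz0_ge1.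
by move=> ?; rewrite ler0_norm; lra.
Qed.

End slit_length.

(** * A direction with prescribed dyadic approximations *)

Section direction.
Context {R : realType}.
Variable N : nat -> nat.

(** The first argument of [maxn] makes 1 / q_(k+1) at most a quarter of [dir_gap k]; the second lets
    the denominators outrun any given function. *)
Fixpoint dir_exp k : nat :=
  if k is k'.+1 then maxn (2 * dir_exp k' + k' + 7) (N k) else N 0.

Definition dir_den k : nat := (2 ^ dir_exp k)%N.

(** The next fraction is p_k / q_k + [dir_gap k] + 1 / q_(k+1). The last term makes the numerator
    odd, hence coprime to a power of 2. *)
Fixpoint dir_num k : nat :=
  if k is k'.+1 then
    (dir_num k' * 2 ^ (dir_exp k - dir_exp k') +
     2 ^ (dir_exp k - (2 * dir_exp k' + k' + 5)) + 1)%N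
  else 1%N.

Lemma dir_numS k : dir_num k.+1 =
  (dir_num k * 2 ^ (dir_exp k.+1 - dir_exp k) +
   2 ^ (dir_exp k.+1 - (2 * dir_exp k + k + 5)) + 1)%N.
Proof. by []. Qed.

(** This is 2^-(k+5) / q_k^2. An excess of [direction] over p_k / q_k between one and two gaps puts
    q_k eta_k between 2^-(k+5) and 2^-(k+4). *)
Definition dir_gap k : R := (2 ^+ (2 * dir_exp k + k + 5))^-1.
Definition dir_low k : R := (dir_num k)%:R / (dir_den k)%:R + dir_gap k.
Definition direction : R := sup (range dir_low).

Lemma dir_exp_ge k : (N k <= dir_exp k)%N.
Proof. by case: k => [|k] //=; rewrite leq_maxr. Qed.

Lemma dir_expS k : (2 * dir_exp k + k + 7 <= dir_exp k.+1)%N.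
Proof. by rewrite leq_maxl. Qed.

Lemma dir_den_gt0 k : (0 < dir_den k)%N. Proof. by rewrite expn_gt0. Qed.

Lemma dir_den_double k : (2 * dir_den k <= dir_den k.+1)%N.
Proof. by rewrite -expnS leq_exp2l//; have := dir_expS k; lia. Qed.

Lemma dir_coprime k : coprimez (dir_num k) (dir_den k).
Proof.
rewrite /coprimez /gcdz /= eqz_nat -/(coprime _ _) /dir_den.
case: k => [|k]; first by rewrite /= coprime1n.
rewrite coprime_sym; apply: coprimeXl; rewrite coprime2n.
have h := dir_expS k.
have e1 : (dir_exp k.+1 - dir_exp k == 0)%N = false by apply/negbTE; lia.
have e2 : (dir_exp k.+1 - (2 * dir_exp k + k + 5) == 0)%N = false by apply/negbTE; lia.
by rewrite dir_numS !oddD oddM !oddX e1 e2 andbF.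
Qed.

Lemma pow2_divB (a b : nat) : (b <= a)%N -> (2 ^ (a - b))%:R / (2 ^ a)%:R = (2 ^+ b)^-1 :> R.
Proof.
move=> ba; rewrite !natrX -{2}(subnK ba) exprD.
by field; rewrite !expf_neq0// pnatr_eq0.
Qed.

Lemma dir_gap_gt0 k : 0 < dir_gap k.
Proof. by rewrite invr_gt0 exprn_gt0. Qed.

Lemma dir_step k : (dir_num k.+1)%:R / (dir_den k.+1)%:R =
  dir_low k + ((dir_den k.+1)%:R)^-1 :> R.
Proof.
have h := dir_expS k.
rewrite /dir_low /dir_gap -(@pow2_divB (dir_exp k.+1)); last by lia.
rewrite dir_numS !natrD mulrDl mulrDl mul1r natrM.
congr (_ + _ + _); rewrite -mulrA; congr (_ * _).
by rewrite pow2_divB; [rewrite natrX|lia].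
Qed.

(** This makes the intervals from [dir_low k] to [dir_low k + dir_gap k] nested. *)
Lemma dir_gapS k : (dir_den k.+1)%:R^-1 + 2 * dir_gap k.+1 <= dir_gap k.
Proof.
have h := dir_expS k.
have h1 : (dir_den k.+1)%:R^-1 <= dir_gap k / 4.
  have -> : (4 : R) = 2 ^+ 2 by rewrite -natrX.
  rewrite /dir_gap /dir_den natrX -invfM -exprD.
  by rewrite lef_pV2 ?posrE ?exprn_gt0// ler_eXn2l ?ltr1n//; lia.
have h2 : dir_gap k.+1 <= (dir_den k.+1)%:R^-1 / 2.
  rewrite /dir_gap /dir_den natrX -[X in _ / X]expr1 -invfM -exprD.
  by rewrite lef_pV2 ?posrE ?exprn_gt0// ler_eXn2l ?ltr1n//; lia.
have := dir_gap_gt0 k; lra.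
Qed.

Lemma dir_low_homo j k : (j <= k)%N -> dir_low j <= dir_low k.
Proof.
move=> /subnK <-; elim: (k - j)%N => // n IH; apply: (le_trans IH).
rewrite addSn [leRHS]/dir_low dir_step -addrA lerDl.
by apply: addr_ge0; [rewrite invr_ge0|exact/ltW/dir_gap_gt0].
Qed.

Lemma dir_high_homo j k : (j <= k)%N -> dir_low k + dir_gap k <= dir_low j + dir_gap j.
Proof.
move=> /subnK <-; elim: (k - j)%N => // n; apply: le_trans.
rewrite addSn {1}/dir_low dir_step; have := dir_gapS (n + j); lra.
Qed.

Lemma dir_low_high j k : dir_low j <= dir_low k + dir_gap k.
Proof.
apply: le_trans (dir_high_homo (leq_maxr j k)).
apply: le_trans (dir_low_homo (leq_maxl j k)) _.
by rewrite lerDl ltW// dir_gap_gt0.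
Qed.

Lemma direction_itv k : dir_low k <= direction <= dir_low k + dir_gap k.
Proof.
apply/andP; split.
  apply: sup_upper_bound; last by exists k.
  split; first by exists (dir_low 0), 0%N.
  by exists (dir_low 0 + dir_gap 0) => _ [j _ <-]; exact: dir_low_high.
by apply: sup_le_ub => [|_ [j _ <-]]; [exists (dir_low 0), 0%N|exact: dir_low_high].
Qed.

Lemma direction_eta k : let x := (dir_den k)%:R * eta direction (Posz \o dir_num) dir_den k in
  (2 ^+ (k + 5))^-1 <= x <= (2 ^+ (k + 4))^-1.
Proof.
have /andP[lo hi] := direction_itv k; rewrite /dir_low in lo hi.
have q0 : (0 : R) < (dir_den k)%:R by rewrite ltr0n dir_den_gt0.
have gE : dir_gap k * (dir_den k)%:R ^+ 2 = (2 ^+ (k + 5))^-1.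
  rewrite /dir_gap /dir_den natrX -exprM -addnA exprD [(2 * _)%N]mulnC.
  have : (2 : R) ^+ (dir_exp k * 2) != 0 by rewrite expf_neq0 ?pnatr_eq0.
  have : (2 : R) ^+ (k + 5) != 0 by rewrite expf_neq0 ?pnatr_eq0.
  by move: (2 ^+ (k + 5)) (2 ^+ (dir_exp k * 2)) => A B A0 B0; field; apply/andP.
have P4 : (2 ^+ (k + 4))^-1 = 2 * (2 ^+ (k + 5))^-1 :> R.
  by rewrite !addnS !exprS; field; rewrite !expf_neq0 ?addn0 ?pnatr_eq0.
set x := _ * _; have xE : x =
    (direction - (dir_num k)%:R / (dir_den k)%:R) * (dir_den k)%:R ^+ 2.
  by rewrite /x /eta -pmulrn; field; rewrite gt_eqF.
have q2 : (0 : R) < (dir_den k)%:R ^+ 2 by rewrite exprn_gt0.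
rewrite /= xE P4 -gE; apply/andP; split; first by rewrite ler_pM2r//; lra.
by rewrite [leRHS]mulrA ler_pM2r//; lra.
Qed.

End direction.

Lemma ln2_itv (R : realType) : 2^-1 <= ln (2 : R) <= 1.
Proof.
apply/andP; split.
  have := @le_ln1Dx R (- 2^-1); rewrite (_ : 1 + _ = 2^-1) ?lnV ?posrE//; last by lra.
  by rewrite lerN2; apply; lra.
have := @le_ln1Dx R 1; rewrite (_ : 1 + 1 = 2)//; apply; lra.
Qed.

Lemma limf_einf_pinfty_le (R : realType) (f : R -> \bar R) (u : nat -> R) (l : \bar R) :
  (forall n, n%:R <= u n) -> (forall n, (f (u n) <= l)%E) ->
  (limf_einf f (+oo%R : set_system R) <= l)%E.
Proof.
move=> un fl; rewrite limf_einfE.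
apply: ge_ereal_sup => _ [V [M [_ MV]] <-].
pose n := (Num.truncn `|M|).+1.
have Mn : M < n%:R by apply: le_lt_trans (ler_norm M) _; exact: truncnS_gt.
apply: le_trans (fl n); apply: ereal_inf_lbound; exists (u n) => //.
by apply: MV; exact: lt_le_trans (un n).
Qed.

Theorem theorem1p3 (R : realType) (r : R -> R)
    (hr : r t @[t --> +oo] --> +oo) :
  exists S : translation_surface R,
    [/\ zeros S !=set0,
        vertical_nonergodic (flat S) &
        (limf_einf (fun t : R => (teich_depth S t / r t)%:E)
                   (+oo%R : set_system R) < 1)%E].
Proof.
(* The depth at the k-th time will be at most 2 (k + 5), so the constant 4 bounds the quotient by
   1/2; [k <= n] sends the times to infinity. *)
have rlarge k : exists n : nat, (k <= n)%N /\
    forall t, n%:R <= t -> 4 * (k + 5)%:R <= r t.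
  have [M [_ MP]] := (cvgryPge r).1 hr (4 * (k + 5)%:R).
  pose n := (Num.truncn `|M|).+1.
  have Mn : M < n%:R by apply: le_lt_trans (ler_norm M) _; exact: truncnS_gt.
  exists (maxn k n); split; first exact: leq_maxl.
  move=> t nt; apply: MP; apply: (lt_le_trans Mn); apply: le_trans nt.
  by rewrite ler_nat leq_maxr.
have [N HN] := choice rlarge.
pose alpha : R := direction N.
pose p := Posz \o dir_num N; pose q := dir_den N.
have eta_itv k := @direction_eta R N k.
have eta_ge k : (2 ^+ (k + 5))^-1 <= (q k)%:R * eta alpha p q k.
  by have /andP[] := eta_itv k.
have eta_le k : (q k)%:R * eta alpha p q k <= (2 ^+ (k + 4))^-1.
  by have /andP[] := eta_itv k.
have q_gt0 := dir_den_gt0 N; have q_double := dir_den_double N.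
have eta_gt0 := q_eta_gt0 q_gt0 eta_ge.
have beta01 := slit_length_itv q_gt0 q_double eta_ge eta_le.
set beta := slit_length alpha p q in beta01.
exists (slit_cover alpha beta01); split.
- rewrite zeros_slit_cover; exists (pt alpha beta (branch_pt beta false) false).
  by apply/sing_pt; exact: branch_pt_branch.
- apply: (@slit_cover_nonergodic _ _ _ p q) => //.
  + by move=> k; exact: beta_sum_le_slit.
  + by move=> x; exact: beta_sum_lt_slit.
have /andP[ln2_ge ln2_le] := ln2_itv R.
pose u k : R := 2 * ln (q k)%:R.
have uE k : u k = (2 * ln 2) * (dir_exp N k)%:R.
  by rewrite /u /q /dir_den natrX lnXn// -mulr_natr; ring.
have u_ge k : (dir_exp N k)%:R <= u k.
  by rewrite uE ler_peMl//; lra.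
apply: (@le_lt_trans _ _ (2^-1)%:E); last by rewrite lte_fin; lra.
apply: (@limf_einf_pinfty_le _ _ u) => k.
  apply: le_trans (u_ge k); rewrite ler_nat.
  exact: leq_trans (HN k).1 (dir_exp_ge N k).
have rk : 4 * (k + 5)%:R <= r (u k).
  apply: (HN k).2; apply: le_trans (u_ge k); rewrite ler_nat.
  exact: dir_exp_ge.
have k0 : (0 : R) < (k + 5)%:R by rewrite ltr0n addnS.
have P0 : 0 < (2 ^+ (k + 4))^-1 :> R by rewrite invr_gt0 exprn_gt0.
have P1 : (2 ^+ (k + 4))^-1 <= 1 :> R.
  by rewrite invf_le1 ?exprn_gt0// exprn_ege1// ler1n.
have depth : teich_depth (slit_cover alpha beta01) (u k) <=
    - 2 * ln ((2 ^+ (k + 4))^-1 / 2).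
  apply: (@teich_depth_le _ alpha beta beta01 (p k) (q k)) => //.
  - exact: dir_coprime.
  - exact/ltW/eta_gt0.
  - exact: le_trans (eta_le k) P1.
  - by rewrite P0.
  - by move=> n; exact: slit_length_far.
(* The preceding bound equals 2 (k + 5) ln 2, and ln 2 <= 1. *)
have depth' : teich_depth (slit_cover alpha beta01) (u k) <= 2 * (k + 5)%:R.
  apply: (le_trans depth).
  rewrite -invfM -exprSr -addnS lnV ?posrE ?exprn_gt0// lnXn//.
  rewrite mulrNN -[_ *+ (k + 5)]mulr_natr mulrA ler_pM2r//; lra.
have r0 : 0 < r (u k) by lra.
rewrite lee_fin ler_pdivrMr//; lra.
Qed.
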